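(* Let $n\ge 3$ and let $M\subset\mathbb{R}^{n+1}$ be a compact connected smooth embedded hypersurface with the induced Riemannian metric $g$. Suppose $M$ admits a Killing vector field $\xi$ (with respect to $g$) with $g(\xi,\xi)\equiv 1$. Then $n+1=2N$ is even, $M$ is diffeomorphic to the sphere $S^{n}$, and, after applying a rigid motion of $\mathbb{R}^{n+1}$ and a linear isometric identification $\mathbb{R}^{n+1}\cong\mathbb{C}^N$, $M$ is the complex ellipsoid $$\{(z_1,\dots,z_N)\in\mathbb{C}^N:\ |\omega_1 z_1|^2+|\omega_2 z_2|^2+\cdots+|\omega_N z_N|^2=1\}$$ for some nonzero real numbers $\omega_1,\dots,\omega_N$, and $\xi$ is the restriction to $M$ of the vector field $(z_1,\dots,z_N)\mapsto(i\omega_1 z_1,\dots,i\omega_N z_N)$. Moreover, if $A$ denotes the shape operator of $M$ with respect to a unit normal field and the function $g(A\xi,\xi)$ is constant on $M$, then $\omega_1^2=\omega_2^2=\cdots=\omega_N^2$, so $M$ is a round hypersphere (of constant curvature) $|z_1|^2+\cdots+|z_N|^2=1/\omega_1^2$.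
   Context: The shape operator $A$ of a hypersurface with unit normal field $\nu$ is $A(X)=-D_X\nu$, where $D$ is the Euclidean derivative. A Killing vector field of a Riemannian manifold is a vector field whose flow consists of isometries. *)

(* Defs.v *)
From HB Require Import structures.
From mathcomp Require Import all_boot all_order all_algebra.
From mathcomp Require Import all_classical all_reals all_analysis.
Set Implicit Arguments. Unset Strict Implicit. Unset Printing Implicit Defensive.
Import Order.TTheory GRing.Theory Num.Theory.
Import numFieldNormedType.Exports.
Local Open Scope classical_set_scope.
Local Open Scope ring_scope.

Section Defs.
Variable R : realType.

Definition dot (m : nat) (u v : 'rV[R]_m) : R := \sum_(i < m) u 0 i * v 0 i.

Fixpoint iterD (V W : normedModType R) (vs : seq V) (f : V -> W) : V -> W :=
  match vs with
  | [::] => f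
  | v :: vs' => fun x => 'D_v (iterD vs' f) x
  end.

Definition smooth_on (V W : normedModType R) (U : set V) (f : V -> W) : Prop :=
  open U /\ forall (vs : seq V) (x : V), U x ->
    {for x, continuous (iterD vs f)} /\ forall v : V, derivable (iterD vs f) x v.

Definition local_ext (V W : normedModType R) (S : set V) (f : V -> W) (p : V)
  (U : set V) (F : V -> W) : Prop :=
  U p /\ smooth_on U F /\ (forall x, S x -> U x -> F x = f x).

Definition smooth_map_on (V W : normedModType R) (S : set V) (f : V -> W) : Prop :=
  forall p, S p -> exists U F, @local_ext V W S f p U F.

Definition local_def (m : nat) (M : set 'rV[R]_m) (p : 'rV[R]_m)
  (U : set 'rV[R]_m) (phi : 'rV[R]_m -> R) : Prop :=
  U p /\ smooth_on U phi /\
  (forall x, U x -> exists v, 'D_v phi x != 0) /\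
  (forall x, U x -> (M x <-> phi x = 0)).

Definition hypersurface (m : nat) (M : set 'rV[R]_m) : Prop :=
  forall p, M p -> exists U phi, local_def M p U phi.

Definition tangent (m : nat) (M : set 'rV[R]_m) (p v : 'rV[R]_m) : Prop :=
  exists U phi, local_def M p U phi /\ 'D_v phi p = 0.

Definition vector_field (m : nat) (M : set 'rV[R]_m) (xi : 'rV[R]_m -> 'rV[R]_m) : Prop :=
  smooth_map_on M xi /\ forall p, M p -> tangent M p (xi p).

Definition isometry_of (m : nat) (M : set 'rV[R]_m) (f : 'rV[R]_m -> 'rV[R]_m) : Prop :=
  (forall p, M p -> M (f p)) /\ smooth_map_on M f /\
  forall p v U F, M p -> tangent M p v -> local_ext M f p U F ->
    dot ('D_v F p) ('D_v F p) = dot v v.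

Definition flow_of (m : nat) (M : set 'rV[R]_m) (xi : 'rV[R]_m -> 'rV[R]_m)
  (Phi : R -> 'rV[R]_m -> 'rV[R]_m) : Prop :=
  forall p, M p ->
    Phi 0 p = p /\
    (forall t, M (Phi t p)) /\
    (forall s t, Phi s (Phi t p) = Phi (s + t) p) /\
    (forall t, derivable (fun s => Phi s p) t 1 /\
               'D_1 (fun s => Phi s p) t = xi (Phi t p)).

Definition killing (m : nat) (M : set 'rV[R]_m) (xi : 'rV[R]_m -> 'rV[R]_m) : Prop :=
  vector_field M xi /\
  exists Phi, flow_of M xi Phi /\ forall t, isometry_of M (Phi t).

Definition unit_sphere (m : nat) : set 'rV[R]_m := [set x | dot x x = 1].

Definition diffeomorphic (m : nat) (M S : set 'rV[R]_m) : Prop :=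
  exists f g : 'rV[R]_m -> 'rV[R]_m,
    (forall x, M x -> S (f x)) /\ (forall y, S y -> M (g y)) /\
    (forall x, M x -> g (f x) = x) /\ (forall y, S y -> f (g y) = y) /\
    smooth_map_on M f /\ smooth_map_on S g.

(* nat-indexed coordinate y_i (0 outside range).  R^(2N) is identified with
   C^N via z_k = y_(2k) + i y_(2k+1). *)
Definition coord (m : nat) (y : 'rV[R]_m.+1) (i : nat) : R :=
  if (i < m.+1)%N then y 0 (inord i) else 0.

Definition cellipsoid (m N : nat) (omega : nat -> R) : set 'rV[R]_m.+1 :=
  [set y | \sum_(k < N) (omega k) ^+ 2 *
      ((coord y (2 * k)%N) ^+ 2 + (coord y (2 * k).+1) ^+ 2) = 1].

(* the vector field z |-> (i omega_1 z_1, ..., i omega_N z_N) in real coordinates *)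
Definition rot_field (m : nat) (omega : nat -> R) (y : 'rV[R]_m.+1) : 'rV[R]_m.+1 :=
  \row_(i < m.+1)
    (if odd i then omega i./2 * coord y i.-1 else - (omega i./2 * coord y i.+1)).

Definition unit_normal (m : nat) (M : set 'rV[R]_m) (nu : 'rV[R]_m -> 'rV[R]_m) : Prop :=
  smooth_map_on M nu /\
  forall p, M p -> dot (nu p) (nu p) = 1 /\ forall v, tangent M p v -> dot (nu p) v = 0.

(* g(A xi, xi) = - <D_xi nu, xi> is constant on M (computed with any smooth
   local extension of nu) *)
Definition shape_xi_const (m : nat) (M : set 'rV[R]_m) (nu xi : 'rV[R]_m -> 'rV[R]_m) : Prop :=
  exists c : R, forall p U F, M p -> local_ext M nu p U F ->
    - dot ('D_(xi p) F p) (xi p) = c.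

End Defs.

(* Main.v *)
(**
A unit Killing field [xi] on a hypersurface [M] is an infinitesimal isometric bending.  In a graph
chart, let [f] be the graph function and [w] the component of [xi] along the transverse direction.
The Killing equation determines all second derivatives of [xi] from [w], [f] and their
derivatives, and the symmetry of third derivatives gives the linearised Gauss equation
[f_bd w_ac - f_ad w_bc = f_bc w_ad - f_ac w_bd].  Where the Hessian of [f] has no isotropic vector,
three mutually conjugate directions (this is where [n >= 3] enters) force the Hessian of [w] to
vanish, so that [xi = x A + c] locally with [A] skew.  Differentiating [|xi| = 1] twice gives
[<D_a xi, D_b xi> = f_ab D_xi w], whence the Hessian of [f] has no isotropic vector exactly where
[A] is invertible.  This holds at the point of [M] farthest from the origin, and it propagates
over [M] by connectedness, with the same [A] and [c].  Thus [M] lies in the connected ellipsoid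
[|x A + c| = 1], in which it is open and closed, and the normal form of [A] gives the complex
coordinates.  Finally [xi A = g(S xi, xi) nu] for a unit normal [nu] with shape operator [S], so
if [g(S xi, xi)] is constant, then [|u A|] is constant on unit vectors and all frequencies agree
up to sign.
*)
Require Import Defs.
From HB Require Import structures.
From mathcomp Require Import all_boot all_order all_algebra.
From mathcomp Require Import all_classical all_reals all_analysis.
From mathcomp Require Import ring lra zify.
Set Implicit Arguments. Unset Strict Implicit. Unset Printing Implicit Defensive.
Import Order.TTheory GRing.Theory Num.Theory.
Import numFieldNormedType.Exports.
Local Open Scope classical_set_scope.
Local Open Scope ring_scope.

(** * Differential calculus *)

Section Calculus.
Variable R : realType.

Lemma near_normP (V : normedModType R) (x : V) (P : V -> Prop) :
  (\near x, P x) <-> exists2 d : R, 0 < d & forall y, `|y - x| < d -> P y.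
Proof.
split=> [/nbhs_ballP[d /= d0 Pd]|[d d0 Pd]].
  by exists d => // y yx; apply: Pd; rewrite -ball_normE /= distrC.
by apply/nbhs_ballP; exists d => // y; rewrite -ball_normE /= distrC => /Pd.
Qed.

Lemma near_open (T : topologicalType) (U : set T) x : open U -> U x -> \near x, U x.
Proof. by move=> oU Ux; apply: open_nbhs_nbhs. Qed.

Lemma near_eq_continuous (T S : topologicalType) (f g : T -> S) x :
  (\near x, f x = g x) -> {for x, continuous f} -> {for x, continuous g}.
Proof.
move=> fg cf; rewrite /prop_for /continuous_at -(nbhs_singleton fg).
by apply: cvg_trans cf; exact: near_eq_cvg.
Qed.

Lemma continuous_sum (T : topologicalType) (I : Type) (r : seq I) (F : I -> T -> R) x :
  (forall i, {for x, continuous (F i)}) ->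
  {for x, continuous (fun y => \sum_(i <- r) F i y)}.
Proof. by move=> cF; apply: (cvg_big add_continuous) => i _; exact: cF. Qed.

Lemma continuous_prod (T : topologicalType) (I : Type) (r : seq I) (F : I -> T -> R) x :
  (forall i, {for x, continuous (F i)}) ->
  {for x, continuous (fun y => \prod_(i <- r) F i y)}.
Proof. by move=> cF; apply: (cvg_big mul_continuous) => i _; exact: cF. Qed.

Lemma continuous_det (T : topologicalType) m (A : T -> 'M[R]_m) x :
  (forall i j, {for x, continuous (fun y => A y i j)}) ->
  {for x, continuous (fun y => \det (A y))}.
Proof.
move=> cA; apply: continuous_sum => s; apply: continuousM; first exact: cst_continuous.
by apply: continuous_prod => i; exact: cA.
Qed.

Lemma continuous_eq_of_near (T : topologicalType) (V : normedModType R) (f g : T -> V) x :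
  {for x, continuous f} -> {for x, continuous g} ->
  (forall A, nbhs x A -> exists y z, [/\ A y, A z & f y = g z]) -> f x = g x.
Proof.
move=> cf cg near_eq; apply/eqP; rewrite -subr_eq0 -normr_le0; apply/ler_addgt0Pl => eps eps0.
have e2 : 0 < eps / 2 by rewrite divr_gt0.
have /cvgrPdist_lt/(_ _ e2) nf := cf; have /cvgrPdist_lt/(_ _ e2) ng := cg.
have [y [z [[fy _] [_ gz] fg]]] := near_eq _ (filterI nf ng).
rewrite addr0 -(subrKA (f y)) [leRHS]splitr [in X in _ + X]fg.
by rewrite (le_trans (ler_normD _ _))// lerD// ltW// distrC.
Qed.

Lemma is_derive1_continuous (V : normedModType R) (f : R -> V) t df :
  is_derive t (1 : R) f df -> {for t, continuous f}.
Proof. by case=> dft _; apply/differentiable_continuous/derivable1_diffP. Qed.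

Lemma is_derive_line (V W : normedModType R) (f : V -> W) x v t :
  derivable f (x + t *: v) v ->
  is_derive t (1 : R) (fun s : R => f (x + s *: v)) ('D_v f (x + t *: v)).
Proof.
move=> df.
have quotE : (fun h : R => h^-1 *: (f (x + (h *: (1 : R) + t) *: v) - f (x + t *: v)))
   = (fun h : R => h^-1 *: (f (h *: v + (x + t *: v)) - f (x + t *: v))).
  by apply/funext => h; rewrite [h *: 1]mulr1 scalerDl addrCA.
by split; [rewrite /derivable quotE | rewrite /derive quotE].
Qed.

Lemma line_cvg (V : normedModType R) (x v : V) : (fun t : R => x + t *: v) @ (0 : R) --> x.
Proof.
rewrite -[X in _ --> X]addr0 -[X in _ --> _ + X](scale0r v).
by apply: cvgD; [exact: cvg_cst | apply: cvgZr_tmp; exact: cvg_id].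
Qed.

Lemma MVT_line (V : normedModType R) (f : V -> R) x v (t : R) :
  (forall k : R, 0 <= k <= 1 -> derivable f (x + (k * t) *: v) v) ->
  exists2 k : R, 0 <= k <= 1 & f (x + t *: v) - f x = t * 'D_v f (x + (k * t) *: v).
Proof.
move=> df; pose g s := f (x + (s * t) *: v).
have dg (s : R) : 0 <= s <= 1 -> is_derive s (1 : R) g ('D_v f (x + (s * t) *: v) * t).
  move=> /df/(@is_derive_line _ _ f) dfs.
  have dst : is_derive s (1 : R) (fun s => s * t) t.
    by apply: is_derive_eq; rewrite scaler0 add0r [_ *: _]mulr1.
  exact: (@is_derive1_comp _ _ (fun r => r * t) _ _ _ dfs dst).
have [||k k01] := @MVT_segment _ g (fun s => 'D_v f (x + (s * t) *: v) * t) 0 1 ler01.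
- by move=> s /subset_itv_oo_cc; rewrite in_itv; exact: dg.
- apply: continuous_in_subspaceT => s; rewrite inE /= in_itv => /dg.
  exact: is_derive1_continuous.
rewrite /g mul1r mul0r scale0r addr0 subr0 mulr1 mulrC => fE.
by exists k => //; rewrite in_itv in k01.
Qed.

Lemma is_derive_line0 (V W : normedModType R) (f : V -> W) x v :
  derivable f x v -> is_derive (0 : R) (1 : R) (fun s : R => f (x + s *: v)) ('D_v f x).
Proof. by move=> df; have := @is_derive_line _ _ f x v 0; rewrite scale0r addr0; exact. Qed.

Lemma near_derive0_cst (V : normedModType R) (f : V -> R) x :
  (\forall y \near x, forall v, is_derive y v f 0) -> \forall y \near x, f y = f x.
Proof.
move=> /near_normP[d d0 df]; apply/near_normP; exists d => // y yx.
have dk (k : R) : 0 <= k <= 1 -> is_derive (x + (k * 1) *: (y - x)) (y - x) f 0.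
  move=> /andP[k0 k1]; apply: df; rewrite mulr1 addrC addKr normrZ ger0_norm//.
  by apply: le_lt_trans yx; rewrite ler_piMl.
have [k /dk[]//|k /dk[_ ->]] := @MVT_line _ f x (y - x) 1.
by rewrite mulr0 scale1r subrKC => /eqP; rewrite subr_eq0 => /eqP.
Qed.

Lemma near_max_derive0 (f : R -> R) x :
  (\forall t \near x, derivable f t 1) -> (\forall t \near x, f t <= f x) ->
  'D_1 f x = 0.
Proof.
move=> df fmax; have [d d0 dmax] := (near_normP _ _).1 (filterI df fmax).
have in_ball t : t \in `]x - d, x + d[ -> `|t - x| < d.
  by rewrite in_itv /= -ltr_distl.
have x_in : x \in `]x - d, x + d[ by rewrite in_itv /= ltrBlDr ltrDl d0.
have [|||_ //] := @derive1_at_max _ f (x - d) (x + d) x _ _ x_in.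
- by rewrite lerD2l ge0_cp// ltW.
- by move=> t /in_ball/dmax[].
- by move=> t /in_ball/dmax[].
Qed.

Lemma second_derive_max (f f' : R -> R) (L : R) :
  (\forall t \near 0, is_derive t (1 : R) f (f' t)) -> is_derive (0 : R) (1 : R) f' L ->
  (\forall t \near 0, f t <= f 0) -> L <= 0.
Proof.
move=> df [df' <-] fmax; rewrite leNgt; apply/negP => L0.
have f'0 : f' 0 = 0.
  have [_ <-] := nbhs_singleton df; apply: near_max_derive0 fmax.
  by apply: filterS df => t [].
have : \forall t \near (0 : R)^', 0 < t^-1 *: (f' (t *: (1 : R) + 0) - f' 0).
  exact: (cvgr_gt _ df' _ L0).
rewrite f'0; under eq_near do rewrite addr0 subr0 [_ *: 1]mulr1.
rewrite /dnbhs near_withinE => f'pos.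
have [d d0 near0] := (near_normP _ _).1 (filterI (filterI df fmax) f'pos).
pose s := d / 2; have s0 : 0 < s by rewrite divr_gt0.
have ds t : 0 <= t <= s -> `|t - 0| < d.
  move=> /andP[t0 ts]; rewrite subr0 ger0_norm// (le_lt_trans ts)//.
  by rewrite ltr_pdivrMr// ltr_pMr ?ltr1n.
have [||t] := @MVT _ f f' 0 s s0.
- by move=> t /subset_itv_oo_cc; rewrite in_itv /= => /ds/near0[[]].
- apply: continuous_in_subspaceT => t; rewrite inE /= in_itv /= => /ds/near0[[+ _] _].
  exact: is_derive1_continuous.
rewrite in_itv /= subr0 => /andP[t0 ts] fsE.
have [|_ /(_ (lt0r_neq0 t0))] := near0 t; first by apply: ds; rewrite !ltW.
rewrite pmulr_rgt0 ?invr_gt0// => f't.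
have [|[_ +] _] := near0 s; first by apply: ds; rewrite ltW /=.
by rewrite -subr_le0 fsE leNgt mulr_gt0.
Qed.

End Calculus.

Arguments near_normP {R V x P}.
Arguments MVT_line {R V f x v t}.

(** * The Euclidean inner product *)

Section Dot.
Variables (R : realType) (m : nat).
Implicit Types (u v w : 'rV[R]_m) (A : 'M[R]_m).

Lemma dotE u v : dot u v = (u *m v^T) 0 0.
Proof. by rewrite mxE; apply: eq_bigr => i _; rewrite mxE. Qed.

Lemma dotC u v : dot u v = dot v u.
Proof. by apply: eq_bigr => i _; rewrite mulrC. Qed.

Lemma dotDl u v w : dot (u + v) w = dot u w + dot v w.
Proof. by rewrite !dotE mulmxDl mxE. Qed.

Lemma dotDr u v w : dot w (u + v) = dot w u + dot w v.
Proof. by rewrite !(dotC w) dotDl. Qed.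

Lemma dotZl (k : R) u v : dot (k *: u) v = k * dot u v.
Proof. by rewrite !dotE -scalemxAl mxE. Qed.

Lemma dotZr (k : R) u v : dot v (k *: u) = k * dot v u.
Proof. by rewrite !(dotC v) dotZl. Qed.

Lemma dotNl u v : dot (- u) v = - dot u v.
Proof. by rewrite -scaleN1r dotZl mulN1r. Qed.

Lemma dotNr u v : dot v (- u) = - dot v u.
Proof. by rewrite -scaleN1r dotZr mulN1r. Qed.

Lemma dotBl u v w : dot (u - v) w = dot u w - dot v w.
Proof. by rewrite dotDl dotNl. Qed.

Lemma dotBr u v w : dot w (u - v) = dot w u - dot w v.
Proof. by rewrite dotDr dotNr. Qed.

Lemma dot0l u : dot 0 u = 0.
Proof. by rewrite dotE mul0mx mxE. Qed.

Lemma dot0r u : dot u 0 = 0.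
Proof. by rewrite dotC dot0l. Qed.

Lemma dot_ge0 u : 0 <= dot u u.
Proof. by apply: sumr_ge0 => i _; rewrite -expr2 sqr_ge0. Qed.

Lemma dot_eq0 u : (dot u u == 0) = (u == 0).
Proof.
apply/eqP/eqP => [u0|->]; last by rewrite dot0l.
apply/rowP => i; rewrite mxE; apply/eqP; rewrite -sqrf_eq0 expr2.
by rewrite (psumr_eq0P _ u0 (i := i))// => j _; rewrite -expr2 sqr_ge0.
Qed.

Lemma dot_gt0 u : (0 < dot u u) = (u != 0).
Proof. by rewrite lt_def dot_ge0 andbT dot_eq0. Qed.

Lemma dot1_neq0 u : dot u u = 1 -> u != 0.
Proof. by move=> u1; rewrite -dot_gt0 u1. Qed.

Lemma dot_delta i u : dot 'e_i u = u 0 i.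
Proof.
rewrite /dot (bigD1 i)//= mxE !eqxx mul1r big1 ?addr0// => j ji.
by rewrite mxE eqxx (negPf ji) mul0r.
Qed.

Lemma dot_ext u v : (forall a, dot a u = dot a v) -> u = v.
Proof. by move=> uv; apply/rowP => i; rewrite -!dot_delta uv. Qed.

Lemma coord_le1 u i : dot u u = 1 -> `|u 0 i| <= 1.
Proof.
move=> u1; rewrite -(@ler_pXn2r _ 2)// ?nnegrE// expr1n -normrX ger0_norm ?sqr_ge0//.
rewrite -u1 /dot (bigD1 i)//= -expr2 lerDl; apply: sumr_ge0 => j _.
by rewrite -expr2 sqr_ge0.
Qed.

Lemma normalize_dot1 u : u != 0 ->
  dot ((Num.sqrt (dot u u))^-1 *: u) ((Num.sqrt (dot u u))^-1 *: u) = 1.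
Proof.
rewrite -dot_gt0 => u0.
by rewrite dotZl dotZr mulrA -expr2 exprVn sqr_sqrtr ?ltW// mulVf// gt_eqF.
Qed.

Lemma dot_mulmxl u v A : dot (u *m A) v = dot u (v *m A^T).
Proof. by rewrite !dotE trmx_mul trmxK mulmxA. Qed.

Lemma dot_skew u v A : A^T = - A -> dot (u *m A) v = - dot u (v *m A).
Proof. by move=> AT; rewrite dot_mulmxl AT mulmxN dotNr. Qed.

Lemma dot_skew0 u A : A^T = - A -> dot (u *m A) u = 0.
Proof.
move=> AT; have := dot_skew u u AT; rewrite [dot u (u *m A)]dotC => /eqP.
by rewrite -addr_eq0 -mulr2n mulrn_eq0 /= => /eqP.
Qed.

Lemma skewP A : A^T = - A <-> forall u, dot (u *m A) u = 0.
Proof.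
split=> [AT u|A0]; first exact: dot_skew0.
apply/matrixP => i j; rewrite !mxE; apply/eqP; rewrite -addr_eq0; apply/eqP.
have := A0 ('e_i + 'e_j); rewrite mulmxDl dotDl !dotDr !A0 add0r addr0.
by rewrite -!rowE ![dot (row _ _) _]dotC !dot_delta !mxE addrC.
Qed.

Lemma exists_orthogonal (s : seq 'rV[R]_m) : (size s < m)%N ->
  exists2 b, dot b b = 1 & {in s, forall u, dot u b = 0}.
Proof.
move=> sm; pose A := \matrix_(i < size s) s`_i.
have : kermx A^T != 0.
  rewrite -mxrank_eq0 mxrank_ker subn_eq0 -ltnNge mxrank_tr.
  exact: leq_ltn_trans (rank_leq_row _) _.
case/rowV0Pn => b /sub_kermxP bA /normalize_dot1 b1; eexists; first exact: b1.
move=> u us; rewrite dotZr.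
have si : (index u s < size s)%N by rewrite index_mem.
have /matrixP/(_ 0 (Ordinal si)) := bA; rewrite !mxE => ub.
rewrite [dot u b](_ : _ = 0) ?mulr0//; rewrite -[RHS]ub dotC.
by apply: eq_bigr => j _; rewrite !mxE /= nth_index.
Qed.

Lemma exists_orthogonal3 u v w : (3 < m)%N ->
  exists2 b, dot b b = 1 & [/\ dot u b = 0, dot v b = 0 & dot w b = 0].
Proof.
move=> m3; have [b b1 orth] := @exists_orthogonal [:: u; v; w] m3.
by exists b => //; split; apply: orth; rewrite !inE eqxx ?orbT.
Qed.

End Dot.

(** * Smooth functions *)

Section IterD.
Variables (R : realType) (V W : normedModType R).
Implicit Types (f : V -> W) (U : set V).

Lemma iterD_rcons vs v f : Defs.iterD (rcons vs v) f = Defs.iterD vs ('D_v f).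
Proof. by elim: vs => //= a vs ->. Qed.

Lemma smooth_open U f : smooth_on U f -> open U. Proof. by case. Qed.

Lemma smooth_continuous U f x : smooth_on U f -> U x -> {for x, continuous f}.
Proof. by move=> [_ sf] Ux; have [] := sf [::] x Ux. Qed.

Lemma smooth_derivable U f x v : smooth_on U f -> U x -> derivable f x v.
Proof. by move=> [_ sf] Ux; have [_] := sf [::] x Ux. Qed.

Lemma smooth_is_derive U f x v : smooth_on U f -> U x -> is_derive x v f ('D_v f x).
Proof. by move=> sf Ux; apply: derivableP; exact: smooth_derivable sf Ux. Qed.

Lemma smooth_derive U f v : smooth_on U f -> smooth_on U ('D_v f).
Proof.
move=> [oU sf]; split=> // vs x Ux.
by have := sf (rcons vs v) x Ux; rewrite iterD_rcons.
Qed.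

Lemma smooth_sub U U' f : open U' -> U' `<=` U -> smooth_on U f -> smooth_on U' f.
Proof. by move=> oU' sU [_ sf]; split=> // vs x /sU; apply: sf. Qed.

Lemma near_smooth U f x : smooth_on U f -> U x -> \near x, U x.
Proof. by move=> /smooth_open; exact: near_open. Qed.

End IterD.

Arguments smooth_derivable {R V W U f x} v _ _.
Arguments smooth_is_derive {R V W U f x} v _ _.

Section RealValued.
Variables (R : realType) (V : normedModType R).
Implicit Types (f g : V -> R) (U : set V).

Fixpoint Ck k U f : Prop :=
  (forall x, U x -> {for x, continuous f}) /\
  if k is k'.+1 then
    forall v, (forall x, U x -> derivable f x v) /\ Ck k' U ('D_v f)
  else True.

Lemma Ck_continuous k U f x : Ck k U f -> U x -> {for x, continuous f}.
Proof. by case: k => [|k] [cf _]; exact: cf. Qed.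

Lemma smooth_onP U f : smooth_on U f <-> open U /\ forall k, Ck k U f.
Proof.
split=> [[oU sf]|[oU sf]]; split=> //.
  move=> k; elim: k f sf => [|k IH] f sf /=.
    by split=> // x Ux; have [] := sf [::] x Ux.
  split=> [x Ux|v]; first by have [] := sf [::] x Ux.
  split=> [x Ux|]; first by have [_] := sf [::] x Ux.
  by apply: IH => vs x Ux; have := sf (rcons vs v) x Ux; rewrite iterD_rcons.
move=> vs; elim/last_ind: vs f sf => [|vs v IH] f sf x Ux /=.
  split; first exact: Ck_continuous (sf 0%N) Ux.
  by move=> v; have [_ /(_ v) []] := sf 1%N => + _; apply.
rewrite iterD_rcons; apply: IH => // k.
by have [_ /(_ v) []] := sf k.+1.
Qed.

Lemma Ck_eq k U f g : open U -> {in U, f =1 g} -> Ck k U f -> Ck k U g.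
Proof.
move=> oU; elim: k f g => [|k IH] f g fg [cf df]; (split; last first).
- by [].
- move=> x Ux; apply: near_eq_continuous (cf x Ux).
  by apply: filterS (near_open oU Ux) => y Uy; rewrite fg ?inE.
- have fg_near x : U x -> \near x, f x = g x.
    by move=> Ux; apply: filterS (near_open oU Ux) => y Uy; rewrite fg ?inE.
  move=> v; have [dv /IH Cv] := df v; split=> [x Ux|].
    by apply: near_eq_derivable (dv x Ux); exact: fg_near.
  by apply: Cv => x; rewrite inE => Ux; apply: near_eq_derive; exact: fg_near.
- move=> x Ux; apply: near_eq_continuous (cf x Ux).
  by apply: filterS (near_open oU Ux) => y Uy; rewrite fg ?inE.
Qed.

Lemma Ck_le k U f : Ck k.+1 U f -> Ck k U f.
Proof.
elim: k f => [|k IH] f; first by case.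
by move=> [cf df]; split=> // v; have [dv /IH] := df v.
Qed.

Lemma Ck_add k U f g : open U -> Ck k U f -> Ck k U g -> Ck k U (fun x => f x + g x).
Proof.
move=> oU; elim: k f g => [|k IH] f g [cf df] [cg dg]; split=> //;
  try by move=> x Ux; apply: continuousD; [exact: cf | exact: cg].
move=> v; have [dfv Cf] := df v; have [dgv Cg] := dg v; split=> [x Ux|].
  by apply: derivableD; [exact: dfv | exact: dgv].
apply: Ck_eq (IH _ _ Cf Cg) => // x; rewrite inE => Ux.
by rewrite deriveD//; [exact: dfv | exact: dgv].
Qed.

Lemma Ck_mul k U f g : open U -> Ck k U f -> Ck k U g -> Ck k U (fun x => f x * g x).
Proof.
move=> oU; elim: k f g => [|k IH] f g Cf Cg; have [cf df] := Cf;
  have [cg dg] := Cg; split=> //;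
  try by move=> x Ux; apply: continuousM; [exact: cf | exact: cg].
move=> v; have [dfv Cdf] := df v; have [dgv Cdg] := dg v; split=> [x Ux|].
  by apply: derivableM; [exact: dfv | exact: dgv].
have Cf_Dg := IH _ _ (Ck_le Cf) Cdg; have Cg_Df := IH _ _ (Ck_le Cg) Cdf.
apply: Ck_eq (Ck_add oU Cf_Dg Cg_Df) => // x; rewrite inE => Ux.
by symmetry; exact: deriveM (dfv x Ux) (dgv x Ux).
Qed.

Lemma Ck_cst k U (c : R) : Ck k U (fun=> c).
Proof.
elim: k c => [|k IH] c; split=> //; try by move=> x _; apply: cst_continuous.
move=> v; split=> [x _|]; first exact: derivable_cst.
rewrite (_ : 'D_v _ = fun=> 0); first exact: IH.
by apply/funext => x; exact: derive_cst.
Qed.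

Lemma Ck_sum k U (I : Type) (r : seq I) (F : I -> V -> R) : open U ->
  (forall i, Ck k U (F i)) -> Ck k U (fun x => \sum_(i <- r) F i x).
Proof.
move=> oU CF; elim: r => [|i r IH].
  by apply: Ck_eq (Ck_cst k U 0) => // x _; rewrite big_nil.
by apply: Ck_eq (Ck_add oU (CF i) IH) => // x _; rewrite big_cons.
Qed.

Lemma Ck_inv k U f : open U -> (forall x, U x -> f x != 0) -> Ck k U f ->
  Ck k U (fun x => (f x)^-1).
Proof.
move=> oU f0; elim: k => [|k IH] Cf; have [cf df] := Cf; split=> //;
  try by move=> x Ux; apply: continuousV; [exact: f0 | exact: cf].
move=> v; have [dfv Cdf] := df v; split=> [x Ux|].
  by apply: derivableV; [exact: f0 | exact: dfv].
have Cinv := IH (Ck_le Cf).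
apply: Ck_eq (Ck_mul oU (Ck_cst k U (-1)) (Ck_mul oU (Ck_mul oU Cinv Cinv) Cdf)) => // x.
rewrite inE => Ux; rewrite deriveV//; [|exact: f0 | exact: dfv].
by rewrite mulN1r scaleNr -exprVn expr2.
Qed.

Lemma smooth_eq U f g : {in U, f =1 g} -> smooth_on U f -> smooth_on U g.
Proof.
move=> fg /smooth_onP[oU sf]; apply/smooth_onP; split=> // k.
exact: Ck_eq (sf k).
Qed.

Lemma smooth_add U f g : smooth_on U f -> smooth_on U g -> smooth_on U (fun x => f x + g x).
Proof.
move=> /smooth_onP[oU sf] /smooth_onP[_ sg]; apply/smooth_onP; split=> // k.
exact: Ck_add.
Qed.

Lemma smooth_mul U f g : smooth_on U f -> smooth_on U g -> smooth_on U (fun x => f x * g x).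
Proof.
move=> /smooth_onP[oU sf] /smooth_onP[_ sg]; apply/smooth_onP; split=> // k.
exact: Ck_mul.
Qed.

Lemma smooth_cst U (c : R) : open U -> smooth_on U (fun=> c).
Proof. by move=> oU; apply/smooth_onP; split=> // k; exact: Ck_cst. Qed.

Lemma smooth_opp U f : smooth_on U f -> smooth_on U (fun x => - f x).
Proof.
move=> sf; apply: smooth_eq (smooth_mul (smooth_cst (-1) (smooth_open sf)) sf) => x _.
by rewrite mulN1r.
Qed.

Lemma smooth_inv U f : (forall x, U x -> f x != 0) -> smooth_on U f ->
  smooth_on U (fun x => (f x)^-1).
Proof.
move=> f0 /smooth_onP[oU sf]; apply/smooth_onP; split=> // k.
exact: Ck_inv.
Qed.

Lemma smooth_sum (I : Type) (r : seq I) (F : I -> V -> R) U : open U ->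
  (forall i, smooth_on U (F i)) -> smooth_on U (fun x => \sum_(i <- r) F i x).
Proof.
move=> oU sF; apply/smooth_onP; split=> // k; apply: Ck_sum => // i.
by have /smooth_onP[_ /(_ k)] := sF i.
Qed.

End RealValued.

Section RowVectors.
Variables (R : realType) (m : nat).
Local Notation V := 'rV[R]_m.

Lemma coord_le_norm (x : V) i : `|x 0 i| <= `|x|.
Proof.
rewrite [leRHS]/Num.Def.normr /= mx_normrE.
by apply: le_trans; last exact: (le_bigmax _ _ (0, i)).
Qed.

Lemma norm_le_coord (x : V) (c : R) : 0 <= c -> (forall i, `|x 0 i| <= c) -> `|x| <= c.
Proof.
move=> c0 coord_le; rewrite [leLHS]/Num.Def.normr /= mx_normrE.
by apply: bigmax_le => // -[i j] _ /=; rewrite ord1.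
Qed.

Lemma continuous_rowP (T : topologicalType) (F : T -> V) (t : T) :
  {for t, continuous F} <-> forall i, {for t, continuous (fun s => F s 0 i)}.
Proof.
split=> [cF i|cF].
  by apply: (@continuous_comp _ _ _ F (fun y : V => y 0 i)) => //; exact: coord_continuous.
apply/cvgrPdist_le => eps e0.
have nearF : \forall s \near t, forall i, `|F t 0 i - F s 0 i| <= eps.
  by apply: filter_forall => i; have /cvgrPdist_le/(_ eps e0) := cF i.
by apply: filterS nearF => s Fs; apply: norm_le_coord (ltW e0) _ => i; rewrite !mxE.
Qed.

Lemma derive_coord (W : normedModType R) (F : W -> V) y z i : derivable F y z ->
  'D_z F y 0 i = 'D_z (fun y => F y 0 i) y.
Proof. by move=> /derive_mx ->; rewrite mxE. Qed.

Lemma is_derive_rowP (W : normedModType R) (F : W -> V) (y z : W) (u : V) :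
  is_derive y z F u <-> forall i, is_derive y z (fun y => F y 0 i) (u 0 i).
Proof.
split=> [[dF <-] i|dF].
  by split; [move/derivable_mxP: dF; apply | rewrite (derive_coord i dF)].
have dF' : derivable F y z by apply/derivable_mxP => i j; rewrite ord1; have [] := dF j.
by split=> //; apply/rowP => i; rewrite (derive_coord i dF'); have [] := dF i.
Qed.

Lemma smooth_rowP (W : normedModType R) (F : W -> V) (U : set W) :
  open U -> smooth_on U F <-> forall i, smooth_on U (fun y => F y 0 i).
Proof.
move=> oU; split=> [[_ sF] i|sF].
  have iterDE vs y : U y -> Defs.iterD vs F y 0 i = Defs.iterD vs (fun z => F z 0 i) y.
    elim: vs y => [|v vs IH] y Uy //=; rewrite derive_coord; last by have [_] := sF vs y Uy.
    by apply: near_eq_derive; apply: filterS (near_open oU Uy).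
  have near_iterDE vs y : U y ->
      \near y, Defs.iterD vs F y 0 i = Defs.iterD vs (fun z => F z 0 i) y.
    by move=> Uy; apply: filterS (near_open oU Uy) => z; exact: iterDE.
  split=> // vs y Uy; have [/continuous_rowP cF dF] := sF vs y Uy.
  split=> [|v]; first exact: near_eq_continuous (near_iterDE _ _ Uy) (cF i).
  apply: near_eq_derivable (near_iterDE _ _ Uy) _.
  by move/derivable_mxP: (dF v); apply.
have derivableF vs y v : (forall y, U y -> forall i,
      Defs.iterD vs F y 0 i = Defs.iterD vs (fun z => F z 0 i) y) ->
    U y -> derivable (Defs.iterD vs F) y v.
  move=> FE Uy; apply/derivable_mxP => i j; rewrite ord1.
  have := ((sF j).2 vs y Uy).2 v; apply: near_eq_derivable.
  by apply: filterS (near_open oU Uy) => z Uz; rewrite FE.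
have iterDE vs y : U y -> forall i, Defs.iterD vs F y 0 i = Defs.iterD vs (fun z => F z 0 i) y.
  elim: vs y => [|v vs IH] y Uy i //=; rewrite derive_coord; last exact: (derivableF _ _ _ IH).
  by apply: near_eq_derive; apply: filterS (near_open oU Uy) => z /IH.
split=> // vs y Uy; split=> [|v]; last exact: (derivableF _ _ _ (iterDE vs)).
apply/continuous_rowP => i; have [cF _] := (sF i).2 vs y Uy.
by apply: near_eq_continuous cF; apply: filterS (near_open oU Uy) => z Uz; rewrite iterDE.
Qed.

Lemma smooth_row (W : normedModType R) (F : W -> V) (U : set W) i :
  smooth_on U F -> smooth_on U (fun y => F y 0 i).
Proof. by move=> sF; move/(smooth_rowP _ (smooth_open sF)): sF; apply. Qed.

Lemma is_derive_coord i (x v : V) : is_derive x v (fun y : V => y 0 i) (v 0 i).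
Proof. exact: (is_derive_rowP _ _ _ _).1 (is_derive_id x v) i. Qed.

Lemma is_derive_scaler (W : normedModType R) (f : W -> R) (y z : W) c (u : V) :
  is_derive y z f c -> is_derive y z (fun y => f y *: u) (c *: u).
Proof.
move=> df; apply/is_derive_rowP => i; rewrite mxE.
have -> : (fun y => (f y *: u) 0 i) = fun y => f y * u 0 i by apply/funext => x; rewrite mxE.
have [dfu Dfu] := is_deriveM df (is_derive_cst (u 0 i) y z).
by split=> //; rewrite Dfu scaler0 add0r /GRing.scale /= mulrC.
Qed.

Lemma smooth_id (U : set V) : open U -> smooth_on U (fun y : V => y).
Proof.
move=> oU; apply/smooth_rowP => // i; apply/smooth_onP; split=> // k.
have cc x : {for x, continuous (fun y : V => y 0 i)} by exact: coord_continuous.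
case: k => [|k] //=; split=> // v; split=> [x _|]; first by have [] := is_derive_coord i x v.
rewrite (_ : 'D_v _ = fun=> v 0 i); first exact: Ck_cst.
by apply/funext => x; have [_ ->] := is_derive_coord i x v.
Qed.

Lemma continuous_dot (T : topologicalType) (F G : T -> V) (t : T) :
  {for t, continuous F} -> {for t, continuous G} ->
  {for t, continuous (fun y => dot (F y) (G y))}.
Proof.
move=> /continuous_rowP cF /continuous_rowP cG; apply: continuous_sum => i.
by apply: continuousM; [exact: cF | exact: cG].
Qed.

Lemma is_derive_dot (W : normedModType R) (F G : W -> V) (y z : W) (u w : V) :
  is_derive y z F u -> is_derive y z G w ->
  is_derive y z (fun t => dot (F t) (G t)) (dot (F y) w + dot u (G y)).
Proof.
move=> /is_derive_rowP dF /is_derive_rowP dG.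
have -> : (fun t => dot (F t) (G t)) = \sum_(i < m) (fun t => F t 0 i * G t 0 i).
  by apply/funext => t; rewrite fct_sumE.
have dFG i : is_derive y z (fun t => F t 0 i * G t 0 i) (F y 0 i * w 0 i + u 0 i * G y 0 i).
  by have := is_deriveM (dF i) (dG i); rewrite /GRing.scale /= [u 0 i * _]mulrC.
by have := is_derive_sum dFG; rewrite big_split; exact.
Qed.

Lemma smooth_dot (W : normedModType R) (F G : W -> V) (U : set W) :
  smooth_on U F -> smooth_on U G -> smooth_on U (fun y => dot (F y) (G y)).
Proof.
move=> sF sG; apply: smooth_sum (smooth_open sF) _ => i.
by apply: smooth_mul; exact: smooth_row.
Qed.

Lemma near_derive0_cst_row (W : normedModType R) (F : W -> V) (y : W) :
  (\forall z \near y, forall v, is_derive z v F 0) -> \forall z \near y, F z = F y.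
Proof.
move=> dF; have nearF : \forall z \near y, forall i, F z 0 i = F y 0 i.
  apply: filter_forall => i; apply: (@near_derive0_cst _ _ (fun z => F z 0 i)).
  apply: filterS dF => z dFz v; have := (is_derive_rowP F z v 0).1 (dFz v) i.
  by rewrite mxE.
by apply: filterS nearF => z Fz; apply/rowP.
Qed.

Lemma mulmx_coord n (x : 'rV[R]_n) (A : 'M[R]_(n, m)) i : (x *m A) 0 i = dot x (row i A^T).
Proof. by rewrite mxE; apply: eq_bigr => j _; rewrite !mxE. Qed.

End RowVectors.

Section RightMultiplication.
Variables (R : realType) (m n : nat) (A : 'M[R]_(m, n)).

Lemma continuous_mulmx (T : topologicalType) (F : T -> 'rV[R]_m) (t : T) :
  {for t, continuous F} -> {for t, continuous (fun y => F y *m A)}.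
Proof.
move=> cF; apply/continuous_rowP => i.
have -> : (fun y => (F y *m A) 0 i) = fun y => dot (F y) (row i A^T).
  by apply/funext => y; exact: mulmx_coord.
by apply: continuous_dot; [exact: cF | exact: cst_continuous].
Qed.

Lemma is_derive_mulmx (W : normedModType R) (F : W -> 'rV[R]_m) (y z : W) (u : 'rV[R]_m) :
  is_derive y z F u -> is_derive y z (fun y => F y *m A) (u *m A).
Proof.
move=> dF; apply/is_derive_rowP => i.
have -> : (fun y => (F y *m A) 0 i) = fun y => dot (F y) (row i A^T).
  by apply/funext => w; exact: mulmx_coord.
have := is_derive_dot dF (is_derive_cst (row i A^T) y z).
by rewrite dot0r add0r -mulmx_coord.
Qed.

Lemma smooth_mulmx (W : normedModType R) (F : W -> 'rV[R]_m) (U : set W) :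
  smooth_on U F -> smooth_on U (fun y => F y *m A).
Proof.
move=> sF; have oU := smooth_open sF; apply/(smooth_rowP _ oU) => i.
apply: smooth_eq (smooth_dot sF _) => [y _|]; first by rewrite mulmx_coord.
by apply/(smooth_rowP _ oU) => j; exact: smooth_cst.
Qed.

End RightMultiplication.

Section Differentiability.
Variables (R : realType) (m : nat).
Local Notation V := 'rV[R]_m.
Implicit Types (x h u v : V) (f : V -> R) (U : set V).

Lemma MVT_coord f x h :
  (forall y, `|y - x| <= `|h| -> forall v, derivable f y v) ->
  exists y : 'I_m -> V, (forall k, `|y k - x| <= `|h|) /\
    f (x + h) - f x = \sum_k h 0 k * 'D_('e_k) f (y k).
Proof.
move=> df; pose partial k : V := \row_j (if (j < k)%N then h 0 j else 0).
have partialS (k : 'I_m) : partial k.+1 = partial k + h 0 k *: 'e_k.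
  apply/rowP => j; rewrite !mxE eqxx /= ltnS leq_eqVlt -val_eqE.
  have [jk|] := eqVneq (val j) k; first by rewrite jk ltnn /= mulr1 add0r (val_inj jk).
  by rewrite mulr0 addr0.
have partial_near (k : 'I_m) (s : R) : 0 <= s <= 1 ->
    `|x + partial k + (s * h 0 k) *: 'e_k - x| <= `|h|.
  move=> /andP[s0 s1]; rewrite addrC !addrA addNr add0r.
  apply: norm_le_coord => // j; rewrite !mxE eqxx /= -val_eqE.
  have [jk|jk] := eqVneq (val j) k.
    rewrite jk ltnn /= mulr1 add0r normrM ger0_norm// -[leRHS]mul1r.
    by rewrite ler_pM ?coord_le_norm.
  by rewrite mulr0 addr0; case: ifP => _; rewrite ?normr0 ?coord_le_norm.
have step (k : 'I_m) : exists y, `|y - x| <= `|h| /\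
    f (x + partial k.+1) - f (x + partial k) = h 0 k * 'D_('e_k) f y.
  rewrite partialS addrA; have [|s s01 fs] := @MVT_line R V f (x + partial k) 'e_k (h 0 k).
    by move=> s /partial_near/df.
  by exists (x + partial k + (s * h 0 k) *: 'e_k); split=> //; exact: partial_near.
have [y fy] := choice step; exists y; split=> [k|]; first by case: (fy k).
under eq_bigr do rewrite -(fy _).2.
rewrite -(big_mkord xpredT (fun k => f (x + partial k.+1) - f (x + partial k))).
rewrite telescope_sumr//; congr (f _ - f _).
  by congr (_ + _); apply/rowP => j; rewrite mxE ltn_ord.
by rewrite -[LHS]addr0; congr (_ + _); apply/rowP => j; rewrite !mxE ltn0.
Qed.

Definition gradient f x : V := \row_j 'D_('e_j) f x.

Lemma linear_dot u : linear (dot u : V -> R).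
Proof. by move=> a v w; rewrite dotDr dotZr. Qed.

HB.instance Definition _ u := GRing.isLinear.Build _ _ _ _ (dot u : V -> R) (linear_dot u).

Lemma C1_diff f x :
  (\near x, forall v, derivable f x v) -> (forall v, {for x, continuous ('D_v f)}) ->
  differentiable f x /\ 'd f x = dot (gradient f x) :> (V -> R).
Proof.
move=> df cf; have cL : continuous (dot (gradient f x)).
  by move=> y; apply: (@continuous_dot R m V (cst _) id); [exact: cst_continuous | exact: cvg_id].
pose L : {linear V -> R} := dot (gradient f x).
have fE : f \o shift x = cst (f x) + L +o_ (0 : V) id.
  apply/eqaddoP => eps e0 /=; pose c := eps / m.+1%:R.
  have c0 : 0 < c by rewrite divr_gt0 ?ltr0n.
  have nearDf : \forall y \near x, forall k, `|'D_('e_k) f x - 'D_('e_k) f y| < c.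
    apply: (@filter_forall _ _ _ _ (nbhs_filter x)) => k.
    by have /cvgrPdist_lt/(_ _ c0) := cf 'e_k; exact.
  have [d d0 dDf] := near_normP.1 (filterI df nearDf).
  near=> h; have hd : `|h| < d by near: h; exact: (@nbhs0_lt R V).
  have [|y [yh fy]] := @MVT_coord f x h.
    by move=> y yh; have [] := dDf y (le_lt_trans yh hd).
  have -> : (f \o shift x - (cst (f x) + L)) h =
      \sum_k h 0 k * ('D_('e_k) f (y k) - 'D_('e_k) f x).
    rewrite [LHS](_ : _ = f (x + h) - f x - L h); last first.
      by rewrite /= [x + h]addrC -addrA -opprD.
    rewrite fy -sumrB; apply: eq_bigr => k _; rewrite mulrBr mxE; congr (_ - _).
    by rewrite mulrC.
  apply: (le_trans (ler_norm_sum _ _ _)).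
  apply: (@le_trans _ _ (\sum_(k < m) `|h| * c)).
    apply: ler_sum => k _; rewrite normrM ler_pM ?coord_le_norm// distrC.
    by have [_ /(_ k)/ltW] := dDf _ (le_lt_trans (yh k) hd).
  rewrite sumr_const card_ord -[leLHS]mulr_natr -mulrA [leLHS]mulrC ler_wpM2r//.
  by rewrite mulrAC ler_pdivrMr ?ltr0n// ler_wpM2l ?(ltW e0)// ler_nat.
have dE : 'd f x = dot (gradient f x) :> (V -> R) by exact: (@diff_unique _ _ _ f L x cL fE).
by split=> //; apply/diff_locallyP; rewrite dE; split.
Unshelve. all: by end_near. Qed.

Lemma smooth_diff U f x : smooth_on U f -> U x ->
  differentiable f x /\ 'd f x = dot (gradient f x) :> (V -> R).
Proof.
move=> sf Ux; apply: C1_diff => [|v].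
  by apply: filterS (near_smooth sf Ux) => y Uy v; exact: smooth_derivable sf Uy.
exact: smooth_continuous (smooth_derive v sf) Ux.
Qed.

Lemma dot_gradient U f x v : smooth_on U f -> U x -> dot (gradient f x) v = 'D_v f x.
Proof. by move=> sf Ux; have [df <-] := smooth_diff sf Ux; rewrite deriveE. Qed.

Lemma continuous_gradient U f x : smooth_on U f -> U x -> {for x, continuous (gradient f)}.
Proof.
move=> sf Ux; apply/continuous_rowP => j.
have -> : (fun y => gradient f y 0 j) = 'D_('e_j) f by apply/funext => y; rewrite mxE.
exact: smooth_continuous (smooth_derive _ sf) Ux.
Qed.

Lemma derive_dirD U f x u v : smooth_on U f -> U x ->
  'D_(u + v) f x = 'D_u f x + 'D_v f x.
Proof. by move=> sf Ux; rewrite -!(dot_gradient _ sf Ux) dotDr. Qed.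

Lemma derive_dirZ U f x c v : smooth_on U f -> U x -> 'D_(c *: v) f x = c * 'D_v f x.
Proof. by move=> sf Ux; rewrite -!(dot_gradient _ sf Ux) dotZr. Qed.

Lemma is_derive_comp (W : normedModType R) U f (c : W -> V) (y z : W) u :
  smooth_on U f -> U (c y) -> is_derive y z c u ->
  is_derive y z (fun y => f (c y)) ('D_u f (c y)).
Proof.
move=> sf Uc [dc cu]; pose k (t : R) := c (y + t *: z).
have k0 : k 0 = c y by rewrite /k scale0r addr0.
have [dk Dk] : is_derive (0 : R) (1 : R) k u by rewrite -cu; exact: is_derive_line0.
have df : differentiable f (k 0) by rewrite k0; have [] := smooth_diff sf Uc.
have dkd : differentiable k 0 by apply/derivable1_diffP.
have dfk : differentiable (f \o k) 0 by exact: differentiable_comp.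
have dfc : derivable (fun y => f (c y)) y z.
  by apply/derivable1P; under eq_fun do rewrite addrC; exact: diff_derivable dfk.
split=> //; have [_ <-] := is_derive_line0 dfc; rewrite -/(f \o k).
by rewrite deriveE// diff_comp//= -[X in 'd f _ X](deriveE _ dkd) Dk -deriveE// k0.
Qed.

Lemma is_derive_comp_row (W : normedModType R) n U (F : V -> 'rV[R]_n) (c : W -> V) (y z : W) u :
  smooth_on U F -> U (c y) -> is_derive y z c u ->
  is_derive y z (fun y => F (c y)) ('D_u F (c y)).
Proof.
move=> sF Uc dc; apply/is_derive_rowP => i.
rewrite (derive_coord i (smooth_derivable u sF Uc)).
exact: is_derive_comp (smooth_row i sF) Uc dc.
Qed.

End Differentiability.

Section Schwarz.
Variables (R : realType) (m : nat).
Local Notation V := 'rV[R]_m.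
Implicit Types (x a b u v : V) (f : V -> R) (U : set V).

Lemma second_difference f U x a b (t : R) : smooth_on U f ->
  (forall y, `|y - x| <= `|t| * (`|a| + `|b|) -> U y) ->
  exists2 y, `|y - x| <= `|t| * (`|a| + `|b|) &
    f (x + t *: a + t *: b) - f (x + t *: a) - (f (x + t *: b) - f x) =
      t * (t * 'D_b ('D_a f) y).
Proof.
move=> sf ballU.
have near_x (k l : R) : 0 <= k <= 1 -> 0 <= l <= 1 ->
    `|x + (k * t) *: a + (l * t) *: b - x| <= `|t| * (`|a| + `|b|).
  move=> /andP[k0 k1] /andP[l0 l1]; rewrite addrC !addrA addNr add0r.
  rewrite (le_trans (ler_normD _ _))// !normrZ (ger0_norm k0) (ger0_norm l0).
  by rewrite mulrDr lerD// -mulrA ler_piMl// mulr_ge0.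
pose g y := f (y + t *: b) - f y.
have dg (k : R) : 0 <= k <= 1 -> is_derive (x + (k * t) *: a) a g
    ('D_a f (x + (k * t) *: a + t *: b) - 'D_a f (x + (k * t) *: a)).
  move=> k01; apply: is_deriveB.
    apply: (@is_derive_comp _ _ _ U f (fun y => y + t *: b)) => //.
      by apply: ballU; have := near_x k 1 k01; rewrite mul1r; apply; rewrite ler01 lexx.
    by apply: is_derive_eq; rewrite addr0.
  apply: smooth_is_derive sf _; apply: ballU.
  by have := near_x k 0 k01; rewrite mul0r scale0r addr0; apply; rewrite ler01 lexx.
have [k /dg[]//|k k01 gk] := @MVT_line R V g x a t.
have [l l01|l l01 Dfl] := @MVT_line R V ('D_a f) (x + (k * t) *: a) b t.
  exact: smooth_derivable (smooth_derive a sf) (ballU _ (near_x _ _ k01 l01)).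
exists (x + (k * t) *: a + (l * t) *: b); first exact: near_x.
by have [_ Dg] := dg k k01; rewrite -Dfl -Dg -gk /g addrAC.
Qed.

Lemma derive_comm U f x u v : smooth_on U f -> U x ->
  'D_u ('D_v f) x = 'D_v ('D_u f) x.
Proof.
move=> sf Ux.
apply: (@continuous_eq_of_near _ _ R ('D_u ('D_v f)) ('D_v ('D_u f))) => [||A nA].
- exact: smooth_continuous (smooth_derive u (smooth_derive v sf)) Ux.
- exact: smooth_continuous (smooth_derive v (smooth_derive u sf)) Ux.
have [d d0 dA] := near_normP.1 (filterI nA (near_smooth sf Ux)).
pose c := `|u| + `|v|; pose t := d / (c + 1).
have c0 : 0 <= c by rewrite addr_ge0.
have t0 : 0 < t by rewrite divr_gt0// ltr_wpDl.
have ballAU y : `|y - x| <= `|t| * c -> A y /\ U y.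
  move=> yx; apply: dA; rewrite (le_lt_trans yx)// gtr0_norm//.
  by rewrite mulrAC ltr_pdivrMr ?ltr_wpDl// ltr_pM2l// ltrDl.
have [y yx|y /ballAU[Ay _] fuv] := @second_difference f U x u v t sf.
  by have [] := ballAU y yx.
have [z zx|z zx fvu] := @second_difference f U x v u t sf.
  by have [] : A z /\ U z by apply: ballAU; rewrite /c [`|u| + _]addrC.
have [Az _] : A z /\ U z by apply: ballAU; rewrite /c [`|u| + _]addrC.
exists z, y; split; [exact: Az | exact: Ay | move: fuv fvu].
move: ('D_v ('D_u f) y) ('D_u ('D_v f) z) => Dvu Duv fuv fvu.
do 2!apply: (mulfI (lt0r_neq0 t0)); rewrite -fuv -fvu [x + t *: v + _]addrAC.
by ring.
Qed.

Lemma is_derive_gradient U f x v : smooth_on U f -> U x ->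
  is_derive x v (gradient f) (gradient ('D_v f) x).
Proof.
move=> sf Ux; apply/is_derive_rowP => j; rewrite mxE (derive_comm _ _ sf Ux).
have -> : (fun y => gradient f y 0 j) = 'D_('e_j) f by apply/funext => y; rewrite mxE.
exact: smooth_is_derive (smooth_derive _ sf) Ux.
Qed.

End Schwarz.

Section Composition.
Variables (R : realType) (m : nat) (W : normedModType R).
Local Notation V := 'rV[R]_m.

Lemma Ck_comp k (U : set V) (B : set W) (f : V -> R) (c : W -> V) :
  open B -> smooth_on U f -> (forall y, B y -> U (c y)) ->
  (forall i, Ck k B (fun y => c y 0 i)) -> Ck k B (fun y => f (c y)).
Proof.
move=> oB; elim: k f => [|k IH] f sf cU Cc.
  split=> // y By; apply: continuous_comp (smooth_continuous sf (cU y By)).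
  by apply/continuous_rowP => i; exact: Ck_continuous (Cc i) By.
have dc y v : B y -> is_derive y v c (\row_i 'D_v (fun y => c y 0 i) y).
  move=> By; apply/is_derive_rowP => i; rewrite mxE; apply: derivableP.
  by have [_ /(_ v)[+ _]] := Cc i; apply.
have dfc y v (By : B y) := is_derive_comp sf (cU y By) (dc y v By).
split=> [y By|v]; first exact: Ck_continuous (IH f sf cU (fun i => Ck_le (Cc i))) By.
split=> [y /(dfc _ v)[]//|].
pose Dfc y := \sum_i 'D_('e_i) f (c y) * 'D_v (fun y => c y 0 i) y.
apply: (@Ck_eq _ _ _ _ Dfc) => // [y|].
  rewrite inE => By; have [_ ->] := dfc y v By; rewrite -(dot_gradient _ sf (cU y By)).
  by apply: eq_bigr => i _; rewrite !mxE.
apply: Ck_sum => // i; apply: Ck_mul => //.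
  by apply: IH (smooth_derive _ sf) cU _ => j; exact: Ck_le (Cc j).
by have [_ /(_ v)[]] := Cc i.
Qed.

Lemma smooth_comp (U : set V) (B : set W) (f : V -> R) (c : W -> V) :
  smooth_on U f -> smooth_on B c -> (forall y, B y -> U (c y)) ->
  smooth_on B (fun y => f (c y)).
Proof.
move=> sf sc cU; have oB := smooth_open sc; apply/smooth_onP; split=> // k.
by apply: Ck_comp sf cU _ => // i; have /smooth_onP[_] := smooth_row i sc.
Qed.

Lemma smooth_comp_row n (U : set V) (B : set W) (F : V -> 'rV[R]_n) (c : W -> V) :
  smooth_on U F -> smooth_on B c -> (forall y, B y -> U (c y)) ->
  smooth_on B (fun y => F (c y)).
Proof.
move=> sF sc cU; apply/smooth_rowP => [|i]; first exact: smooth_open sc.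
exact: smooth_comp (smooth_row i sF) sc cU.
Qed.

End Composition.

(** * Hypersurfaces and their graph charts *)

Section DefiningFrame.
Variables (R : realType) (m : nat).
Local Notation V := 'rV[R]_m.
Implicit Types (M U : set V) (phi : V -> R) (e p v x h : V).

(* [e] points out of the zero set of [phi], so that [M] is near each point of [U] a graph over
   the displacements transverse to [e]. *)
Definition defining_frame M U phi e :=
  [/\ smooth_on U phi, (forall x, U x -> 'D_e phi x != 0) &
      forall x, U x -> (M x <-> phi x = 0)].

Lemma defining_frame_sub M U U' phi e : open U' -> U' `<=` U ->
  defining_frame M U phi e -> defining_frame M U' phi e.
Proof.
move=> oU' sU [sphi e_phi M_phi]; split; first exact: smooth_sub sphi.
- by move=> x /sU/e_phi.
- by move=> x /sU/M_phi.
Qed.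

Lemma local_def_frame M U phi p e : local_def M p U phi -> 'D_e phi p != 0 ->
  exists U', [/\ U' p, U' `<=` U & defining_frame M U' phi e].
Proof.
move=> [Up [sphi [_ M_phi]]] e0; pose A := U `&` [set x | 'D_e phi x != 0].
have nA : nbhs p A.
  apply: filterI (near_smooth sphi Up) _.
  exact: (cvgr_neq0 _ (smooth_continuous (smooth_derive e sphi) Up) e0).
exists (A°); split=> //; first by move=> x /interior_subset[].
split=> [|x /interior_subset[]//|x /interior_subset[/M_phi]//].
by apply: smooth_sub sphi; [exact: open_interior | move=> x /interior_subset[]].
Qed.

Lemma hypersurface_frame M p : hypersurface M -> M p ->
  exists U phi e, U p /\ defining_frame M U phi e.
Proof.
move=> hM /hM[U [phi ld]]; have [Up [_ [phi_reg _]]] := ld.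
have [e e0] := phi_reg p Up; have [U' [U'p _ fr]] := local_def_frame ld e0.
by exists U', phi, e.
Qed.

Lemma frame_local_def M U phi e p : defining_frame M U phi e -> U p -> local_def M p U phi.
Proof. by move=> [sphi e_phi M_phi] Up; split=> //; split=> //; split=> // x /e_phi; exists e. Qed.

Definition graph_point p e (tau : V -> R) h : V := p + h + tau h *: e.

Lemma near_tube p e (P : V -> Prop) : (\near p, P p) ->
  exists2 d : R, 0 < d & \forall h \near (0 : V), forall t, `|t| <= d -> P (p + h + t *: e).
Proof.
move=> nP; have : \forall ht \near ((0 : V), (0 : R)), P (p + ht.1 + ht.2 *: e).
  have c : {for ((0 : V), (0 : R)), continuous (fun ht : V * R => p + ht.1 + ht.2 *: e)}.
    apply: continuousD; first by apply: continuousD; [exact: cst_continuous | exact: cvg_fst].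
    by apply: continuousZr_tmp; exact: cvg_snd.
  by apply: c; rewrite /= addr0 scale0r addr0.
move=> [[A D] [/= nA /near_normP[d d0 dD]] AD]; exists (d / 2); first by rewrite divr_gt0.
apply: filterS nA => h Ah t td; apply: (AD (h, t)); split=> //=; apply: dD.
by rewrite subr0 (le_lt_trans td)// ltr_pdivrMr// ltr_pMr ?ltr1n.
Qed.

End DefiningFrame.

Section GraphChart.
Variables (R : realType) (m : nat).
Local Notation V := 'rV[R]_m.
Variables (M U : set V) (phi : V -> R) (e : V).
Hypothesis fr : defining_frame M U phi e.
Implicit Types (p v x h : V).

Let sphi : smooth_on U phi. Proof. by case: fr. Qed.
Let e_transverse x : U x -> 'D_e phi x != 0. Proof. by case: fr => _ + _; apply. Qed.
Let M_zero x : U x -> M x -> phi x = 0. Proof. by case: fr => _ _ M_phi /M_phi[]. Qed.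

Lemma near_frame_line p : U p -> exists2 d : R, 0 < d & forall t, `|t| <= d ->
  U (p + t *: e) /\ 0 < 'D_e phi (p + t *: e) * 'D_e phi p.
Proof.
move=> Up; have De0 := e_transverse Up.
have nearD : \forall x \near p, U x /\ 0 < 'D_e phi x * 'D_e phi p.
  apply: filterI (near_smooth sphi Up) _.
  have cD : {for p, continuous (fun x => 'D_e phi x * 'D_e phi p)}.
    apply: continuousM; last exact: cst_continuous.
    exact: smooth_continuous (smooth_derive e sphi) Up.
  by apply: (cvgr_gt _ cD); rewrite -expr2 exprn_even_gt0.
have [d d0 /nbhs_singleton tube] := near_tube e nearD.
by exists d => // t /tube; rewrite addr0.
Qed.

Lemma sign_change p (eps : R) : M p -> U p -> 0 < eps -> exists2 r : R, 0 < r <= eps &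
  [/\ U (p + r *: e), U (p + (- r) *: e) & phi (p + r *: e) * phi (p + (- r) *: e) < 0].
Proof.
move=> Mp Up eps0; have [d d0 lineU] := near_frame_line Up.
pose r := Num.min eps d; have r0 : 0 < r by rewrite lt_min eps0.
have [r_eps rd] : r <= eps /\ r <= d by rewrite !ge_min !lexx orbT.
have sign t : `|t| <= r -> t != 0 -> 0 < phi (p + t *: e) * (t * 'D_e phi p).
  move=> tr t0; have lineUk (k : R) : 0 <= k <= 1 ->
      U (p + (k * t) *: e) /\ 0 < 'D_e phi (p + (k * t) *: e) * 'D_e phi p.
    move=> /andP[k0 k1]; apply: lineU; rewrite normrM (ger0_norm k0) (le_trans _ rd)//.
    by rewrite (le_trans _ tr)// ler_piMl.
  have [k /lineUk[Uk _]|k /lineUk[_ Dk]] := @MVT_line R V phi p e t.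
    exact: smooth_derivable sphi Uk.
  by rewrite (M_zero Up Mp) subr0 => ->; rewrite mulrACA mulr_gt0// -expr2 exprn_even_gt0.
exists r; first by rewrite r0.
split; [have [] := lineU r | have [] := lineU (- r) |] => //; rewrite ?normrN ?gtr0_norm//.
have := sign r; have := sign (- r); rewrite normrN gtr0_norm// lexx oppr_eq0 gt_eqF//.
rewrite mulNr mulrN oppr_gt0 => /(_ isT isT) + /(_ isT isT).
move: (phi _) (phi _) (r * _) => a b c bc ac.
have c0 : c != 0 by apply: contraTneq bc => ->; rewrite mulr0 ltxx.
have := nmulr_llt0 (a * c) bc; rewrite ac mulrACA => /esym.
by rewrite pmulr_llt0// -expr2 exprn_even_gt0.
Qed.

Lemma zero_crossing p (eps : R) : M p -> U p -> 0 < eps ->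
  \forall h \near (0 : V), exists t : R,
    [/\ `|t| <= eps, U (p + h + t *: e) & M (p + h + t *: e)].
Proof.
move=> Mp Up eps0; have [d d0 tubeU] := near_tube e (near_smooth sphi Up).
have [|r /andP[r0]] := @sign_change p (Num.min eps d) Mp Up; first by rewrite lt_min eps0.
rewrite le_min => /andP[r_eps rd] [Ur UNr opposite].
have opposite_near : \forall h \near (0 : V),
    phi (p + h + r *: e) * phi (p + h + (- r) *: e) < 0.
  have cphi (t : R) : U (p + t *: e) -> {for (0 : V), continuous (fun h => phi (p + h + t *: e))}.
    move=> Ut; apply: (@continuous_comp _ _ _ (fun h => p + h + t *: e) phi).
      by apply: continuousD; [apply: continuousD; [exact: cst_continuous | exact: cvg_id] |
                              exact: cst_continuous].
    by apply: smooth_continuous sphi _; rewrite addr0.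
  have cm := continuousM (cphi _ Ur) (cphi _ UNr).
  by apply: (cvgr_lt _ cm); rewrite /= addr0.
near=> h.
have Uh : forall t, `|t| <= r -> U (p + h + t *: e).
  by near: h; apply: filterS tubeU => h Uh t /le_trans/(_ rd); exact: Uh.
have {}opposite : phi (p + h + r *: e) * phi (p + h + (- r) *: e) < 0 by near: h.
have [|||t] := @IVT _ (fun t => phi (p + h + t *: e)) (- r) r 0.
- by rewrite ge0_cp// ltW.
- apply: continuous_in_subspaceT => t; rewrite inE /= in_itv /= -ler_norml => /Uh Uht.
  have := is_derive_line (smooth_derivable e sphi Uht); exact: is_derive1_continuous.
- rewrite ge_min le_max; move: opposite.
  case: (ltgtP (phi (p + h + r *: e)) 0) => [a0|a0|->] /=.
  + by rewrite nmulr_rlt0// => /ltW ->; rewrite orbT.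
  + by rewrite pmulr_rlt0// => /ltW ->; rewrite orbT.
  + by rewrite mul0r ltxx.
rewrite in_itv /= -ler_norml => tr phit; exists t; split; first exact: le_trans tr r_eps.
  exact: Uh.
by case: fr => _ _ /(_ _ (Uh _ tr))[_]; apply.
Unshelve. all: by end_near. Qed.

Lemma vertical_zero_unique x (t : R) : (forall k : R, 0 <= k <= 1 -> U (x + (k * t) *: e)) ->
  M x -> M (x + t *: e) -> t = 0.
Proof.
move=> Uk Mx Mt; have [k /Uk|k /Uk/e_transverse De0] := @MVT_line R V phi x e t.
  exact: smooth_derivable.
have Ux : U x by have := Uk 0; rewrite mul0r scale0r addr0; apply; rewrite lexx ler01.
have Ut : U (x + t *: e) by have := Uk 1; rewrite mul1r; apply; rewrite lexx ler01.
rewrite (M_zero Ux Mx) (M_zero Ut Mt) subrr => /esym/eqP.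
by rewrite mulf_eq0 (negPf De0) orbF => /eqP.
Qed.

Lemma vertical_unique p : U p -> exists2 d : R, 0 < d & \forall h \near (0 : V),
  forall s t : R, `|s| <= d -> `|t| <= d ->
    M (p + h + s *: e) -> M (p + h + t *: e) -> s = t.
Proof.
move=> Up; have [d d0 tubeU] := near_tube e (near_smooth sphi Up).
exists d => //; apply: filterS tubeU => h Uh s t; rewrite !ler_norml.
move=> /andP[s1 s2] /andP[t1 t2] Ms Mt; apply/esym/eqP; rewrite -subr_eq0; apply/eqP.
apply: (@vertical_zero_unique (p + h + s *: e)) => //; last by rewrite -addrA -scalerDl subrKC.
move=> k /andP[k0 k1]; rewrite -addrA -scalerDl; apply: Uh; rewrite ler_norml.
have k1' : 0 <= 1 - k by rewrite subr_ge0.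
by apply/andP; split; nra.
Qed.

Definition slope v x : R := - ('D_v phi x / 'D_e phi x).
Definition lift v x : V := v + slope v x *: e.

Lemma smooth_slope v : smooth_on U (slope v).
Proof.
apply: smooth_opp; apply: smooth_mul; first exact: smooth_derive.
exact: smooth_inv e_transverse (smooth_derive e sphi).
Qed.

Lemma slope_e x : U x -> slope e x = -1.
Proof. by move=> Ux; rewrite /slope divff// e_transverse. Qed.

Lemma derive_lift v x : U x -> 'D_(lift v x) phi x = 0.
Proof.
move=> Ux; rewrite (derive_dirD _ _ sphi)// (derive_dirZ _ _ sphi)// mulNr divfK ?subrr//.
exact: e_transverse.
Qed.

Lemma slope_tangent v x : 'D_v phi x = 0 -> slope v x = 0.
Proof. by move=> v0; rewrite /slope v0 mul0r oppr0. Qed.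

Section ImplicitFunction.
Variables (p : V) (d : R) (B : set V) (tau : V -> R).
Hypothesis d0 : 0 < d.
Hypothesis oB : open B.
Hypothesis uniq : forall h, B h -> forall s t : R, `|s| <= d -> `|t| <= d ->
  M (p + h + s *: e) -> M (p + h + t *: e) -> s = t.
Hypothesis tauP : forall h, B h ->
  [/\ `|tau h| <= d / 2, U (graph_point p e tau h) & M (graph_point p e tau h)].

Lemma implicit_continuous h : B h -> {for h, continuous tau}.
Proof.
move=> Bh; have [tau_h Uh Mh] := tauP Bh.
apply/(@cvgrPdist_le _ _ _ _ (nbhs_filter h)) => eps eps0; pose c := Num.min eps (d / 2).
have c0 : 0 < c by rewrite lt_min eps0 divr_gt0.
have near_h : \forall k \near h, exists t : R,
    [/\ `|t| <= c, U (p + k + (tau h + t) *: e) & M (p + k + (tau h + t) *: e)].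
  have := zero_crossing Mh Uh c0; rewrite (near_shift h).
  apply: filterS => k [t]; rewrite /= sub0r.
  have -> : graph_point p e tau h + (k - h) + t *: e = p + k + (tau h + t) *: e.
    by apply/rowP => i; rewrite !mxE; ring.
  by exists t.
apply: filterS2 (near_open oB Bh) near_h => k Bk [t [tc _ Mt]].
have [tau_k _ Mk] := tauP Bk.
have -> : tau k = tau h + t.
  apply: (uniq Bk) Mk Mt; first by rewrite (le_trans tau_k)// ler_pdivrMr// ler_pMr// ler1n.
  rewrite (le_trans (ler_normD _ _))// [leRHS]splitr lerD//.
  by rewrite (le_trans tc)// ge_min lexx orbT.
by rewrite opprD addNKr normrN (le_trans tc)// ge_min lexx.
Qed.

Lemma implicit_is_derive h v : B h -> is_derive h v tau (slope v (graph_point p e tau h)).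
Proof.
move=> Bh; have [_ Uh Mh] := tauP Bh; set x := graph_point p e tau h in Uh Mh *.
suff quot_cvg : (fun t : R => t^-1 *: (tau (t *: v + h) - tau h)) @ 0^' --> slope v x.
  by split; [exact: cvgP quot_cvg | exact: cvg_lim quot_cvg].
apply/cvgrPdist_lt => eps eps0.
have near_slope : \forall y \near x, U y /\ `|slope v x - slope v y| < eps.
  apply: filterI (near_smooth sphi Uh) _.
  by have /cvgrPdist_lt := smooth_continuous (smooth_slope v) Uh; exact.
have [c c0 ballx] := near_normP.1 near_slope.
pose step (t : R) := t *: v + (tau (t *: v + h) - tau h) *: e.
have shift_cvg : (fun t : R => t *: v + h) @ (0 : R) --> h.
  rewrite -[X in _ --> X]add0r -(scale0r v).
  by apply: cvgD; [apply: cvgZr_tmp; exact: cvg_id | exact: cvg_cst].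
have near_step : \forall t \near (0 : R), `|step t| < c.
  have : step @ (0 : R) --> (0 : R) *: v + (tau h - tau h) *: e.
    apply: cvgD; apply: cvgZr_tmp; first exact: cvg_id.
    apply: cvgB; last exact: cvg_cst.
    exact: (cvg_comp _ tau shift_cvg (implicit_continuous Bh)).
  by rewrite scale0r add0r subrr scale0r => /cvgr0Pnorm_lt; exact.
near=> t; have t0 : t != 0 by near: t; exact: nbhs_dnbhs_neq.
have Bt : B (t *: v + h) by near: t; apply: cvg_within; exact: shift_cvg (near_open oB Bh).
have stepc : `|step t| < c by near: t; exact: cvg_within.
have [_ Ut Mt] := tauP Bt.
have ballk (k : R) : 0 <= k <= 1 ->
    U (x + (k * 1) *: step t) /\ `|slope v x - slope v (x + (k * 1) *: step t)| < eps.
  move=> /andP[k0 k1]; apply: ballx; rewrite mulr1 addrC addKr normrZ ger0_norm//.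
  by rewrite (le_lt_trans _ stepc)// ler_piMl.
have [k /ballk[Uk _]|k /ballk[Uk slope_k]] := @MVT_line R V phi x (step t) 1.
  exact: smooth_derivable sphi Uk.
have -> : x + 1 *: step t = p + (t *: v + h) + tau (t *: v + h) *: e.
  by apply/rowP => i; rewrite !mxE; ring.
rewrite (M_zero Uh Mh) (M_zero Ut Mt) subrr mul1r (derive_dirD _ _ sphi Uk).
rewrite !(derive_dirZ _ _ sphi Uk) => /esym/eqP; rewrite addr_eq0 => /eqP stepE.
suff -> : t^-1 *: (tau (t *: v + h) - tau h) = slope v (x + (k * 1) *: step t) by [].
apply: (mulfI t0); rewrite mulrA divff// mul1r /slope mulrN mulrA stepE mulNr opprK.
by rewrite mulfK// e_transverse.
Unshelve. all: by end_near. Qed.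

Lemma implicit_smooth : smooth_on B tau.
Proof.
apply/smooth_onP; split=> //; elim=> [|k IH]; first by split=> // h /implicit_continuous.
split=> [h /implicit_continuous //|v]; split=> [h /(implicit_is_derive v)[]//|].
apply: (@Ck_eq _ _ _ _ (fun h => slope v (graph_point p e tau h))) => // [h|].
  by rewrite inE => /(implicit_is_derive v)[_ ->].
have tauU h : B h -> U (graph_point p e tau h) by case/tauP.
apply: (Ck_comp oB (smooth_slope v) tauU) => i.
apply: (@Ck_eq _ _ _ _ (fun h : V => (p 0 i + h 0 i) + tau h * e 0 i)) => //.
  by move=> h _; rewrite !mxE.
have coordk : Ck k B (fun h : V => h 0 i) by have /smooth_onP[_] := smooth_row i (smooth_id oB).
exact: Ck_add oB (Ck_add oB (Ck_cst _ _ _) coordk) (Ck_mul oB IH (Ck_cst _ _ _)).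
Qed.

End ImplicitFunction.

Lemma graph_chart p : M p -> U p -> exists (B : set V) (tau : V -> R),
  [/\ B 0, smooth_on B tau,
      forall h, B h -> U (graph_point p e tau h) /\ M (graph_point p e tau h),
      forall h, B h -> M (p + h) -> tau h = 0 &
      forall h v, B h -> is_derive h v tau (slope v (graph_point p e tau h))].
Proof.
move=> Mp Up; have [d d0 near_uniq] := vertical_unique Up.
pose on_graph h (t : R) := [/\ `|t| <= d / 2, U (p + h + t *: e) & M (p + h + t *: e)].
have near_graph : \forall h \near (0 : V), exists t, on_graph h t.
  by apply: zero_crossing => //; rewrite divr_gt0.
have /choice[tau tauP] : forall h, exists t, (exists t, on_graph h t) -> on_graph h t.
  move=> h; have [[t ht]|no_t] := pselect (exists t, on_graph h t); first by exists t.
  by exists 0.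
set B := interior [set h | (forall s t : R, `|s| <= d -> `|t| <= d ->
    M (p + h + s *: e) -> M (p + h + t *: e) -> s = t) /\ exists t, on_graph h t].
have oB : open B by exact: open_interior.
have uniqB h : B h -> forall s t : R, `|s| <= d -> `|t| <= d ->
    M (p + h + s *: e) -> M (p + h + t *: e) -> s = t by case/interior_subset.
have tauB h : B h -> on_graph h (tau h) by move=> /interior_subset[_]; exact: tauP.
have d2d : d / 2 <= d by rewrite ler_pdivrMr// ler_pMr// ler1n.
exists B, tau; split; first exact: filterI.
- exact: implicit_smooth d0 oB uniqB tauB.
- by move=> h /tauB[].
- move=> h Bh Mh; have [tau_d _ Mt] := tauB h Bh.
  apply: (uniqB h Bh) => //; first exact: le_trans tau_d d2d.
    by rewrite normr0 ltW.
  by rewrite scale0r addr0.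
- by move=> h v Bh; exact: implicit_is_derive d0 oB uniqB tauB h v Bh.
Qed.

End GraphChart.

Section Tangent.
Variables (R : realType) (m : nat).
Local Notation V := 'rV[R]_m.
Implicit Types (M E U : set V) (phi g : V -> R) (e p u v x h : V).

Lemma is_derive_graph_point p e tau h v c : is_derive h v tau c ->
  is_derive h v (graph_point p e tau) (v + c *: e).
Proof.
move=> dtau; rewrite -[v in v + _]add0r.
exact: is_deriveD (is_deriveD (is_derive_cst p h v) (is_derive_id h v)) (is_derive_scaler e dtau).
Qed.

Lemma smooth_graph_point p e tau (B : set V) : smooth_on B tau ->
  smooth_on B (graph_point p e tau).
Proof.
move=> stau; have oB := smooth_open stau; apply/(smooth_rowP _ oB) => i.
apply: (@smooth_eq _ _ _ (fun h : V => p 0 i + h 0 i + tau h * e 0 i)) => [h _|].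
  by rewrite !mxE.
apply: smooth_add; last exact: smooth_mul stau (smooth_cst _ oB).
by apply: smooth_add; [exact: smooth_cst | exact: smooth_row i (smooth_id oB)].
Qed.

Lemma tangent_curve M p v : M p -> tangent M p v -> exists k : R -> V,
  [/\ k 0 = p, is_derive (0 : R) (1 : R) k v & \forall t \near (0 : R), M (k t)].
Proof.
move=> Mp [U [phi [ld v0]]]; have [Up [_ [phi_reg _]]] := ld; have [e e0] := phi_reg p Up.
have [U' [U'p _ fr]] := local_def_frame ld e0.
have [B [tau [B0 stau graphM tau0 dtau]]] := graph_chart fr Mp U'p.
have pE : graph_point p e tau 0 = p.
  by rewrite /graph_point tau0 ?addr0// scale0r addr0.
exists (fun t => graph_point p e tau (0 + t *: v)); split.
- by rewrite scale0r addr0.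
- have := is_derive_graph_point p e (dtau 0 v B0).
  rewrite pE (slope_tangent e v0) scale0r addr0 => -[dk Dk].
  by have := @is_derive_line0 R V V (graph_point p e tau) 0 v dk; rewrite Dk.
have : \forall t \near (0 : R), B (0 + t *: v) by exact: line_cvg (near_smooth stau B0).
by apply: filterS => t /graphM[].
Qed.

Lemma tangent_vanish M p v g U : M p -> tangent M p v -> smooth_on U g -> U p ->
  (forall x, M x -> U x -> g x = 0) -> 'D_v g p = 0.
Proof.
move=> Mp Tv sg Up g0; have [k [k0 dk kM]] := tangent_curve Mp Tv.
have Uk : U (k 0) by rewrite k0.
have [_] := is_derive_comp sg Uk dk; rewrite k0 => <-.
rewrite -[RHS](derive_cst (0 : R) (0 : R) (1 : R)); apply: near_eq_derive.
have kU : \forall t \near (0 : R), U (k t).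
  have : k @ (0 : R) --> p by rewrite -k0; exact: is_derive1_continuous dk.
  by move=> /(_ _ (near_smooth sg Up)).
by apply: filterS2 kM kU => t; exact: g0.
Qed.

Lemma frame_tangentP M U phi e p v : defining_frame M U phi e -> U p -> M p ->
  tangent M p v <-> 'D_v phi p = 0.
Proof.
move=> fr Up Mp; have [sphi _ M_phi] := fr; split=> [Tv|v0].
  by apply: tangent_vanish Mp Tv sphi Up _ => x Mx Ux; apply/M_phi.
by exists U, phi; split=> //; exact: frame_local_def fr Up.
Qed.

Lemma tangent_lift M U phi e p v : defining_frame M U phi e -> U p -> M p ->
  tangent M p (lift phi e v p).
Proof. by move=> fr Up Mp; apply/(frame_tangentP _ fr Up Mp); exact: derive_lift fr v p Up. Qed.

Lemma normal_scalar M p nu r : hypersurface M -> M p -> dot nu nu = 1 ->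
  (forall v, tangent M p v -> dot nu v = 0) -> (forall v, tangent M p v -> dot r v = 0) ->
  r = dot r nu *: nu.
Proof.
move=> hM Mp nu1 nuT rT; have [U [phi [e [Up fr]]]] := hypersurface_frame hM Mp.
pose s := r - dot r nu *: nu; have sT v : tangent M p v -> dot s v = 0.
  by move=> Tv; rewrite dotBl dotZl rT// nuT// mulr0 subrr.
have dec v : v = lift phi e v p - slope phi e v p *: e.
  by rewrite /lift -addrA subrr addr0.
have se : dot s e = 0.
  have : dot s nu = 0 by rewrite dotBl dotZl nu1 mulr1 subrr.
  rewrite [nu in dot s nu]dec dotBr sT ?sub0r ?dotZr; last exact: tangent_lift fr Up Mp.
  move=> /eqP; rewrite oppr_eq0 mulf_eq0 => /orP[/eqP slope0|/eqP //].
  have := nuT _ (tangent_lift nu fr Up Mp); rewrite /lift slope0 scale0r addr0 nu1 => /eqP.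
  by rewrite oner_eq0.
suff /eqP : s = 0 by rewrite subr_eq0 => /eqP.
apply: dot_ext => v; rewrite dot0r dotC (dec v) dotBr sT ?dotZr ?se ?mulr0 ?subrr//.
exact: tangent_lift fr Up Mp.
Qed.

Lemma hypersurface_sub_near M E p : hypersurface M -> hypersurface E -> M `<=` E -> M p ->
  \forall x \near p, E x -> M x.
Proof.
move=> hM hE ME Mp; have [U [phi [e [Up fr]]]] := hypersurface_frame hM Mp.
have [U' [psi ld]] := hE p (ME p Mp); have [U'p [spsi [psi_reg E_psi]]] := ld.
have e_psi : 'D_e psi p != 0.
  have [v] := psi_reg p U'p; apply: contraNneq => e0.
  have : 'D_(lift phi e v p) psi p = 0.
    apply: tangent_vanish Mp (tangent_lift v fr Up Mp) spsi U'p _ => x /ME Ex U'x.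
    exact/E_psi.
  by rewrite (derive_dirD _ _ spsi)// (derive_dirZ _ _ spsi)// e0 mulr0 addr0 => ->.
have [U'' [U''p _ frE]] := local_def_frame ld e_psi.
have [d d0 uniqE] := vertical_unique frE U''p.
have near_graph := zero_crossing fr Mp Up d0.
rewrite (near_shift p) in uniqE; rewrite (near_shift p) in near_graph.
apply: filterS2 uniqE near_graph => x uniq [t [td _ Mt]] Ex.
move: uniq Mt; rewrite /= sub0r subrKC => /(_ 0 t); rewrite normr0 scale0r addr0.
by move=> /(_ (ltW d0) td Ex) uniq Mt; move: (Mt); rewrite -uniq ?scale0r ?addr0//; exact: ME.
Qed.

Lemma compact_hypersurface_eq M E : hypersurface M -> hypersurface E -> M `<=` E ->
  compact M -> M !=set0 -> connected E -> M = E.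
Proof.
move=> hM hE ME cM M0 conE; apply: conE => //.
- exists (interior [set x | E x -> M x]); first exact: open_interior.
  apply/seteqP; split=> [x Mx|x [Ex /interior_subset]]; last exact.
  by split; [exact: ME | exact: hypersurface_sub_near hM hE ME Mx].
- exists M; first by apply: compact_closed => //; exact: norm_hausdorff.
  by apply/seteqP; split=> [x Mx|x []//]; split=> //; exact: ME.
Qed.

End Tangent.

(** * The Killing equation *)

Section Increments.
Variables (R : realType) (m : nat).
Local Notation V := 'rV[R]_m.
Implicit Types (x y z p u w : V).

Lemma norm_increment_le (c c' : R -> V) (T K : R) : 0 <= T ->
  (forall t : R, 0 <= t <= T -> is_derive t (1 : R) c (c' t) /\ `|c' t| <= K) ->
  `|c T - c 0| <= T * K.
Proof.
move=> T0 dc; have K0 : 0 <= K.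
  have [|_] := dc 0; first by rewrite lexx.
  exact: le_trans.
apply: norm_le_coord => [|i]; first exact: mulr_ge0.
have dci (k : R) : 0 <= k <= 1 ->
    is_derive ((0 : R) + (k * T) *: 1) (1 : R) (fun t => c t 0 i) (c' (k * T) 0 i) /\
    `|c' (k * T)| <= K.
  move=> /andP[k0 k1]; rewrite add0r [_ *: 1]mulr1.
  have [|dck ck] := dc (k * T); first by rewrite mulr_ge0//= ler_piMl.
  by split=> //; exact: (is_derive_rowP _ _ _ _).1 dck i.
have [k /dci[[]]//|k /dci[[_ ->] ck]] := @MVT_line R R (fun t => c t 0 i) 0 1 T.
rewrite add0r [T *: 1]mulr1 !mxE => ->; rewrite normrM ger0_norm//.
by rewrite ler_wpM2l// (le_trans (coord_le_norm _ _)).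
Qed.

Lemma segment_near x y p (d k : R) : 0 <= k <= 1 -> `|x - p| < d -> `|y - p| < d ->
  `|y + k *: (x - y) - p| < d.
Proof.
move=> /andP[k0 k1] xd yd.
have -> : y + k *: (x - y) - p = (1 - k) *: (y - p) + k *: (x - p).
  by apply/rowP => i; rewrite !mxE; ring.
apply: le_lt_trans (ler_normD _ _) _; rewrite !normrZ (ger0_norm k0) ger0_norm ?subr_ge0//.
have [->|kn0] := eqVneq k 0; first by rewrite subr0 mul1r mul0r addr0.
apply: (@lt_le_trans _ _ ((1 - k) * d + k * d)); last by rewrite -mulrDl subrK mul1r.
by apply: ler_ltD; [rewrite ler_wpM2l ?subr_ge0// ltW | rewrite ltr_pM2l// lt_def kn0].
Qed.

Lemma near_derive_bound (U : set V) (F : V -> V) p : smooth_on U F -> U p ->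
  exists2 L : R, 0 < L & \forall z \near p, U z /\ forall u, `|'D_u F z| <= L * `|u|.
Proof.
move=> sF Up; have sFi i := smooth_row i sF.
pose G z := \sum_i \sum_j `|'D_('e_j) (fun y => F y 0 i) z|.
have cG : {for p, continuous G}.
  apply: continuous_sum => i; apply: continuous_sum => j.
  apply: (@continuous_comp _ _ _ ('D_('e_j) (fun y => F y 0 i)) Num.norm).
    exact: smooth_continuous (smooth_derive _ (sFi i)) Up.
  exact: norm_continuous.
have G0 z : 0 <= G z by do 2 (apply: sumr_ge0 => ? _).
exists (G p + 1); first by rewrite ltr_wpDl.
have nearG : \forall z \near p, G z < G p + 1 by apply: (cvgr_lt _ cG); rewrite ltrDl.
apply: filterS2 (near_smooth sF Up) nearG => z Uz Gz; split=> // u.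
apply: norm_le_coord => [|i]; first by rewrite mulr_ge0// ltW// ltr_wpDl.
rewrite (derive_coord i (smooth_derivable u sF Uz)) -(dot_gradient _ (sFi i) Uz).
apply: le_trans (ler_norm_sum _ _ _) _.
apply: (@le_trans _ _ (G z * `|u|)); last by rewrite ler_wpM2r// ltW.
apply: (@le_trans _ _ (\sum_j `|'D_('e_j) (fun y => F y 0 i) z| * `|u|)).
  by apply: ler_sum => j _; rewrite mxE normrM ler_wpM2l// coord_le_norm.
rewrite -mulr_suml ler_wpM2r// /G [leRHS](bigD1 i)//= lerDl.
by do 2 (apply: sumr_ge0 => ? _).
Qed.

Lemma near_lipschitz (U : set V) (F : V -> V) p : smooth_on U F -> U p ->
  exists2 L : R, 0 < L & exists2 d : R, 0 < d &
    forall x y, `|x - p| < d -> `|y - p| < d -> U x /\ `|F x - F y| <= L * `|x - y|.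
Proof.
move=> sF Up; have [L L0 /near_normP[d d0 dF]] := near_derive_bound sF Up.
exists L => //; exists d => // x y xd yd; split; first by have [] := dF x xd.
have := @norm_increment_le (fun t => F (y + t *: (x - y)))
  (fun t => 'D_(x - y) F (y + t *: (x - y))) 1 (L * `|x - y|) ler01.
rewrite mul1r scale0r scale1r addr0 subrKC; apply=> t t01.
have [Ut dFt] := dF _ (segment_near t01 xd yd); split; last exact: dFt.
exact: is_derive_line (smooth_derivable _ sF Ut).
Qed.

Lemma continuous_deformation (U : set V) (F : V -> V) p u : smooth_on U F -> U p ->
  {for (p, u), continuous (fun zw : V * V => dot zw.2 ('D_zw.2 F zw.1))}.
Proof.
move=> sF Up; have sFi i := smooth_row i sF.
pose deformation (zw : V * V) := \sum_i zw.2 0 i * dot (gradient (fun y => F y 0 i) zw.1) zw.2.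
have cfst : {for (p, u), continuous (fun zw : V * V => zw.1)} by exact: cvg_fst.
have csnd : {for (p, u), continuous (fun zw : V * V => zw.2)} by exact: cvg_snd.
apply: (@near_eq_continuous _ _ deformation).
  have nearU : \forall zw \near (p, u), U zw.1 := cfst _ (near_smooth sF Up).
  apply: filterS nearU => -[z w] /= Uz; apply: eq_bigr => i _.
  by rewrite (derive_coord i (smooth_derivable w sF Uz)) (dot_gradient _ (sFi i) Uz).
apply: continuous_sum => i; apply: continuousM.
  by move/continuous_rowP: csnd; apply.
apply: continuous_dot => //.
apply: (@continuous_comp _ _ _ (fun zw : V * V => zw.1)) => //.
exact: continuous_gradient (sFi i) Up.
Qed.

Lemma deformationZ (U : set V) (F : V -> V) z w (s : R) : smooth_on U F -> U z ->
  dot (s *: w) ('D_(s *: w) F z) = s ^+ 2 * dot w ('D_w F z).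
Proof.
move=> sF Uz; have -> : 'D_(s *: w) F z = s *: 'D_w F z.
  apply/rowP => i; rewrite mxE !(derive_coord i (smooth_derivable _ sF Uz)).
  exact: derive_dirZ (smooth_row i sF) Uz.
by rewrite dotZl dotZr mulrA expr2.
Qed.

Lemma difference_quotient_cvg (c : R -> V) u : is_derive (0 : R) (1 : R) c u ->
  (fun s : R => s^-1 *: (c s - c 0)) @ 0^' --> u.
Proof.
move=> [dc <-]; have -> : (fun s : R => s^-1 *: (c s - c 0)) =
    (fun s : R => s^-1 *: (c (s *: (1 : R) + 0) - c 0)).
  by apply/funext => s; rewrite addr0 [s *: 1]mulr1.
exact: dc.
Qed.

Lemma difference_quotient_sq_cvg (c : R -> V) u : is_derive (0 : R) (1 : R) c u ->
  (fun s : R => dot (s^-1 *: (c s - c 0)) (s^-1 *: (c s - c 0))) @ 0^' --> dot u u.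
Proof.
move=> /difference_quotient_cvg c_cvg; apply: (cvg_comp _ (fun w : V => dot w w) c_cvg).
by apply: (@continuous_dot _ _ V id id); exact: cvg_id.
Qed.

End Increments.

Section Flow.
Variables (R : realType) (m : nat).
Local Notation V := 'rV[R]_m.
Variables (M : set V) (xi : V -> V) (Phi : R -> V -> V).
Hypothesis flow : flow_of M xi Phi.
Implicit Types (x y z p u v w : V) (t T d L : R).

Lemma flow_in t x : M x -> M (Phi t x). Proof. by move=> /flow[_ []]. Qed.

Lemma flow0 x : M x -> Phi 0 x = x. Proof. by move=> /flow[]. Qed.

Lemma flow_is_derive t x : M x -> is_derive t (1 : R) (fun s => Phi s x) (xi (Phi t x)).
Proof. by move=> /flow[_ [_ [_ /(_ t)[dPhi DPhi]]]]; split. Qed.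

Lemma flow_displacement t x : (forall y, M y -> dot (xi y) (xi y) = 1) -> M x -> 0 <= t ->
  `|Phi t x - x| <= t.
Proof.
move=> unit_xi Mx t0; rewrite -[X in _ - X](flow0 Mx) -[leRHS]mulr1.
apply: (@norm_increment_le _ _ (fun s => Phi s x) (fun s => xi (Phi s x)) t 1) => // s _.
split; first exact: flow_is_derive.
by apply: norm_le_coord => // i; apply/coord_le1/unit_xi/flow_in.
Qed.

Lemma flow_stays_near x p d T t : (forall y, M y -> dot (xi y) (xi y) = 1) ->
  M x -> `|x - p| < d / 2 -> T <= d / 2 -> 0 <= t <= T -> `|Phi t x - p| < d.
Proof.
move=> unit_xi Mx xd Td /andP[t0 tT]; rewrite -(subrKA x) [ltRHS]splitr.
rewrite (le_lt_trans (ler_normD _ _))// ler_ltD//.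
by rewrite (le_trans (flow_displacement unit_xi Mx t0))// (le_trans tT).
Qed.

Section Chord.
Variables (p : V) (U : set V) (F : V -> V) (d T : R) (x y : V).
Hypothesis sF : smooth_on U F.
Hypothesis ballU : forall z, `|z - p| < d -> U z.
Hypothesis F_xi : forall z, M z -> U z -> F z = xi z.
Hypothesis Mx : M x.
Hypothesis My : M y.
Hypothesis T0 : 0 < T.
Hypothesis x_near : forall t, 0 <= t <= T -> `|Phi t x - p| < d.
Hypothesis y_near : forall t, 0 <= t <= T -> `|Phi t y - p| < d.

Definition chord t := Phi t x - Phi t y.

Lemma chord_is_derive t : 0 <= t <= T ->
  is_derive t (1 : R) chord (F (Phi t x) - F (Phi t y)).
Proof.
move=> tT; rewrite !F_xi; try (exact: flow_in); try exact: ballU (x_near tT).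
  by apply: is_deriveB; exact: flow_is_derive.
exact: ballU (y_near tT).
Qed.

Lemma chord_separation L t : 0 < L ->
  (forall z w, `|z - p| < d -> `|w - p| < d -> `|F z - F w| <= L * `|z - w|) ->
  T * L <= 2^-1 -> 0 <= t <= T -> `|chord t - chord 0| <= 2 * (T * L) * `|chord 0|.
Proof.
move=> L0 lipF TL tT.
have cn : {within `[0, T], continuous (fun t => `|chord t|)}.
  apply: continuous_in_subspaceT => s; rewrite inE /= in_itv => /chord_is_derive dc.
  apply: (@continuous_comp _ _ _ chord Num.norm); first exact: is_derive1_continuous dc.
  exact: norm_continuous.
have [c] := EVT_max (ltW T0) cn; rewrite in_itv /= => c0T cmax.
have incr s : 0 <= s <= T -> `|chord s - chord 0| <= T * L * `|chord c|.
  move=> /andP[s0 sT]; rewrite -mulrA; apply: le_trans (ler_wpM2r _ sT); last first.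
    by rewrite mulr_ge0// ltW.
  apply: (norm_increment_le s0) => r /andP[r0 rs].
  have rT : 0 <= r <= T by rewrite r0 (le_trans rs).
  split; first exact: chord_is_derive.
  apply: le_trans (lipF _ _ (x_near rT) (y_near rT)) _.
  by rewrite ler_pM2l//; apply: cmax; rewrite in_itv.
have chord_c : `|chord c| <= 2 * `|chord 0|.
  have := incr c c0T; have : `|chord c| <= `|chord c - chord 0| + `|chord 0|.
    by rewrite -[in leLHS](subrK (chord 0) (chord c)) ler_normD.
  have : T * L * `|chord c| <= 2^-1 * `|chord c| by rewrite ler_wpM2r.
  by move: (T * L * _) `|chord c - _| => A B; lra.
apply: le_trans (incr t tT) _.
by rewrite [2 * _]mulrC -[leRHS]mulrA ler_wpM2l// mulr_ge0 ?ltW.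
Qed.

(* the mean value theorem, first in time for the squared length of the chord, then along the
   chord for the vector field *)
Lemma chord_mean_value : exists t z, [/\ 0 <= t <= T, `|z - p| < d &
  dot (chord T) (chord T) - dot (chord 0) (chord 0) =
    2 * T * dot (chord t) ('D_(chord t) F z)].
Proof.
have dsq t : 0 <= t <= T -> is_derive t (1 : R) (fun t => dot (chord t) (chord t))
    (2 * dot (chord t) (F (Phi t x) - F (Phi t y))).
  move=> /chord_is_derive dt; have [dd Dd] := is_derive_dot dt dt.
  by split=> //; rewrite Dd [X in _ + X]dotC mulr_natl mulr2n.
have timeT (k : R) : 0 <= k <= 1 -> 0 <= k * T <= T.
  by move=> /andP[k0 k1]; rewrite mulr_ge0 ?(ltW T0)//= ler_piMl// ltW.
have [k k01|k k01] := @MVT_line R R (fun t => dot (chord t) (chord t)) 0 1 T.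
  by rewrite add0r [_ *: 1]mulr1; have [] := dsq _ (timeT _ k01).
rewrite !add0r [T *: 1]mulr1 [_ *: 1]mulr1; have [_ ->] := dsq _ (timeT _ k01).
set t := k * T => sqE; have tT : 0 <= t <= T by exact: timeT.
have near_seg (l : R) : 0 <= l <= 1 -> `|Phi t y + (l * 1) *: chord t - p| < d.
  by move=> l01; rewrite mulr1; exact: segment_near (x_near tT) (y_near tT).
have dF (l : R) : 0 <= l <= 1 -> is_derive (Phi t y + (l * 1) *: chord t) (chord t)
    (fun z => dot (chord t) (F z))
    (dot (chord t) ('D_(chord t) F (Phi t y + (l * 1) *: chord t))).
  move=> /near_seg/ballU Uz; set z := _ + _ in Uz *.
  have := is_derive_dot (is_derive_cst (chord t) z (chord t)) (smooth_is_derive (chord t) sF Uz).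
  by rewrite dot0l addr0.
have [l /dF[]//|l l01] := @MVT_line R V (fun z => dot (chord t) (F z)) (Phi t y) (chord t) 1.
rewrite scale1r mul1r /chord subrKC -dotBr -/(chord t); have [_ ->] := dF l l01.
move=> FE; exists t, (Phi t y + (l * 1) *: chord t); split=> //; first exact: near_seg.
by rewrite -FE sqE mulrCA mulrA.
Qed.

End Chord.

Lemma isometry_curve (f : V -> V) (k : R -> V) p u : isometry_of M f -> M p -> tangent M p u ->
  k 0 = p -> is_derive (0 : R) (1 : R) k u -> (\forall t \near (0 : R), M (k t)) ->
  exists2 u', is_derive (0 : R) (1 : R) (fun t => f (k t)) u' & dot u' u' = dot u u.
Proof.
move=> [_ [sf isof]] Mp Tu k0 dk kM; have [U [F [Up [sF FE]]]] := sf p Mp.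
exists ('D_u F p); last by apply: (isof p u U F) => //; split.
have Uk0 : U (k 0) by rewrite k0.
have := is_derive_comp_row sF Uk0 dk; rewrite k0; apply: near_eq_is_derive.
have : k @ (0 : R) --> p by rewrite -k0; exact: is_derive1_continuous dk.
move=> /(_ _ (near_smooth sF Up)) kU.
by apply: filterS2 kM kU => t; exact: FE.
Qed.

Lemma isometry_chord_ratio (f : V -> V) p u (eps : R) : isometry_of M f -> M p -> tangent M p u ->
  0 < eps -> exists s x, [/\ s != 0, M x, `|x - p| < eps, `|s^-1 *: (x - p) - u| < eps &
    `|dot (s^-1 *: (f x - f p)) (s^-1 *: (f x - f p)) -
      dot (s^-1 *: (x - p)) (s^-1 *: (x - p))| < eps].
Proof.
move=> isof Mp Tu eps0; have [k [k0 dk kM]] := tangent_curve Mp Tu.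
have [u' dfk u'u] := isometry_curve isof Mp Tu k0 dk kM.
have e2 : 0 < eps / 2 by rewrite divr_gt0.
near (0 : R)^' => s; exists s, (k s); split.
- by near: s; exact: nbhs_dnbhs_neq.
- by near: s; exact: cvg_within kM.
- rewrite distrC; near: s; apply: cvg_within.
  by have := is_derive1_continuous dk; rewrite /prop_for /continuous_at k0 => /cvgrPdist_lt; apply.
- by rewrite distrC -k0; near: s; have /cvgrPdist_lt := difference_quotient_cvg dk; apply.
have sq0 : `|dot u u - dot (s^-1 *: (k s - p)) (s^-1 *: (k s - p))| < eps / 2.
  by rewrite -k0; near: s; have /cvgrPdist_lt := difference_quotient_sq_cvg dk; apply.
have sqf : `|dot u u - dot (s^-1 *: (f (k s) - f p)) (s^-1 *: (f (k s) - f p))| < eps / 2.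
  rewrite -u'u -[in f p]k0; near: s.
  by have /cvgrPdist_lt := difference_quotient_sq_cvg dfk; apply.
move: sq0 sqf; rewrite !ltr_norml.
by move=> /andP[? ?] /andP[? ?]; apply/andP; split; lra.
Unshelve. all: by end_near. Qed.

End Flow.

Section Perturbation.
Variable R : realType.
Implicit Types (d L N : R).

Lemma exists_small_time d L N : 0 < d -> 0 < L -> 0 < N ->
  exists2 T, 0 < T & [/\ T <= d / 2, T * L <= 2^-1 & 2 * (T * L) * N <= d / 2].
Proof.
move=> d0 L0 N0; exists (Num.min (d / 2) (Num.min (2 * L)^-1 (d / (4 * L * N)))).
  by rewrite !lt_min invr_gt0 !divr_gt0 ?mulr_gt0.
set T := Num.min _ _; have T_dL : T <= (2 * L)^-1 by rewrite !ge_min lexx orbT.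
have T_dLN : T <= d / (4 * L * N) by rewrite !ge_min lexx !orbT.
split; first by rewrite ge_min lexx.
  by rewrite invfM ler_pdivlMr in T_dL.
by move: T_dLN; rewrite ler_pdivlMr ?mulr_gt0//; lra.
Qed.

Lemma perturbed_quotient (V : normedModType R) (s K d : R) (b c u : V) : 0 <= K ->
  `|c - b| <= K * `|b| -> K * (`|u| + 1) <= d / 2 ->
  `|s^-1 *: b - u| < 1 -> `|s^-1 *: b - u| < d / 2 -> `|s^-1 *: c - u| < d.
Proof.
move=> K0 cb Kd b1 bd.
have -> : s^-1 *: c - u = s^-1 *: (c - b) + (s^-1 *: b - u) by rewrite scalerBr subrKA.
rewrite [ltRHS]splitr (le_lt_trans (ler_normD _ _))// ler_ltD//.
rewrite normrZ (le_trans (ler_wpM2l (normr_ge0 _) cb))// mulrCA -normrZ (le_trans _ Kd)//.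
rewrite ler_wpM2l// -[s^-1 *: b](subrK u) addrC (le_trans (ler_normD _ _))//.
by rewrite lerD2l ltW.
Qed.

End Perturbation.

Section KillingEquation.
Variables (R : realType) (m : nat).
Local Notation V := 'rV[R]_m.
Variables (M : set V) (xi : V -> V) (Phi : R -> V -> V).
Hypothesis flow : flow_of M xi Phi.
Hypothesis iso : forall t, isometry_of M (Phi t).
Hypothesis unit_xi : forall x, M x -> dot (xi x) (xi x) = 1.
Variables (p u : V) (U : set V) (F : V -> V).
Hypothesis Mp : M p.
Hypothesis Tu : tangent M p u.
Hypothesis extF : local_ext M xi p U F.

(* Joint smoothness of the flow is not given, so instead of exchanging derivatives in time and in
   space we compare the squared chord [|Phi t x - Phi t p|^2] at [t = 0] and at a small time [T]. *)
Lemma flow_deformation_small (eps : R) : 0 < eps -> exists z w,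
  [/\ `|z - p| < eps, `|w - u| < eps & `|dot w ('D_w F z)| < eps].
Proof.
move=> eps0; have [Up [sF F_xi]] := extF.
have [L L0 [d1 d10 lipF]] := near_lipschitz sF Up.
pose d := Num.min d1 eps; have d0 : 0 < d by rewrite lt_min d10.
have d_eps : d <= eps by rewrite ge_min lexx orbT.
have dd1 z : `|z - p| < d -> `|z - p| < d1 by rewrite lt_min => /andP[].
have ballU z : `|z - p| < d -> U z by move=> /dd1 zd; have [] := lipF z z zd zd.
have [|T T0 [Td TL TLu]] := @exists_small_time R d L (`|u| + 1) d0 L0.
  by rewrite ltr_wpDl.
pose c := Num.min (Num.min 1 (d / 2)) (2 * T * eps).
have c0 : 0 < c by rewrite !lt_min ltr01 divr_gt0// !mulr_gt0.
have [s [x [s0 Mx]]] := isometry_chord_ratio (iso T) Mp Tu c0.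
rewrite !lt_min => /andP[/andP[_ xd] _] /andP[/andP[quot1 quot_d] _] /andP[_ sqT].
have x_near t := flow_stays_near (t := t) flow unit_xi Mx xd Td.
have pp : `|p - p| < d / 2 by rewrite subrr normr0 divr_gt0.
have p_near t := flow_stays_near (t := t) flow unit_xi Mp pp Td.
have chord0 : chord Phi x p 0 = x - p by rewrite /chord !(flow0 flow).
have [t [z [tT zd sqE]]] := chord_mean_value flow sF ballU F_xi Mx Mp T0 x_near p_near.
have sep := chord_separation flow ballU F_xi Mx Mp T0 x_near p_near L0
  (fun a b ad bd => (lipF a b (dd1 a ad) (dd1 b bd)).2) TL tT.
rewrite chord0 in sep sqE.
have [w wE] : exists w, w = s^-1 *: chord Phi x p t by eexists.
have chordE : chord Phi x p t = s *: w by rewrite wE scalerA divff// scale1r.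
exists z, w; split; first exact: lt_le_trans zd d_eps.
  rewrite wE; apply: lt_le_trans d_eps; apply: perturbed_quotient sep TLu quot1 quot_d.
  by rewrite !mulr_ge0// ltW.
have T2 : 0 < 2 * T by rewrite mulr_gt0.
suff wE2 : dot (s^-1 *: (Phi T x - Phi T p)) (s^-1 *: (Phi T x - Phi T p)) -
    dot (s^-1 *: (x - p)) (s^-1 *: (x - p)) = 2 * T * dot w ('D_w F z).
  by move: sqT; rewrite wE2 normrM gtr0_norm// ltr_pM2l.
rewrite !dotZl !dotZr !mulrA -mulrBr sqE chordE (deformationZ _ _ sF (ballU z zd)).
by move: (dot w _) => ?; field.
Qed.

Lemma killing_equation : dot u ('D_u F p) = 0.
Proof.
have [Up [sF _]] := extF.
apply/eqP; rewrite -normr_le0; apply/ler_addgt0Pl => eps eps0; rewrite addr0.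
have e2 : 0 < eps / 2 by rewrite divr_gt0.
have /cvgrPdist_lt/(_ _ e2) := continuous_deformation (u := u) sF Up.
move=> /near_normP[d d0 near_pu].
have [|z [w [zd wd Hzw]]] := @flow_deformation_small (Num.min (eps / 2) d).
  by rewrite lt_min e2.
have := near_pu (z, w); rewrite prod_normE /= gt_max.
move: zd wd Hzw; rewrite !lt_min => /andP[_ ->] /andP[_ ->] /andP[Hzw _] /(_ isT) Hpu.
rewrite -[dot u _](subrK (dot w ('D_w F z))) [leRHS]splitr.
by rewrite (le_trans (ler_normD _ _))// lerD// ltW.
Qed.

End KillingEquation.

(** * Local rigidity *)

(* Pointwise forms of [deriveD], [deriveB] and [deriveM]: unifying against the lemmas themselves
   unfolds iterated derivatives. *)
Lemma derive_funD (R : realType) (V : normedModType R) (f g : V -> R) x v :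
  derivable f x v -> derivable g x v -> 'D_v (fun y => f y + g y) x = 'D_v f x + 'D_v g x.
Proof. exact: deriveD. Qed.

Lemma derive_funB (R : realType) (V : normedModType R) (f g : V -> R) x v :
  derivable f x v -> derivable g x v -> 'D_v (fun y => f y - g y) x = 'D_v f x - 'D_v g x.
Proof. exact: deriveB. Qed.

Lemma derive_funM (R : realType) (V : normedModType R) (f g : V -> R) x v :
  derivable f x v -> derivable g x v ->
  'D_v (fun y => f y * g y) x = f x * 'D_v g x + g x * 'D_v f x.
Proof. exact: deriveM. Qed.

Lemma skew_symmetric_eq0 (R : realType) (I : Type) (T : I -> I -> I -> R) :
  (forall a b c, T a b c = T a c b) -> (forall a b c, T a b c = - T b a c) ->
  forall a b c, T a b c = 0.
Proof.
move=> sym skew a b c; have : T a b c = - T a b c; last by lra.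
by rewrite {1}skew sym skew sym skew sym !opprK.
Qed.

Lemma cross_sums_eq0 (R : realFieldType) (fa fb fc wa wb wc : R) : fb != 0 -> fc != 0 ->
  fa * wb + fb * wa = 0 -> fa * wc + fc * wa = 0 -> fb * wc + fc * wb = 0 -> wa = 0.
Proof.
move=> fb0 fc0 ab ac bc.
have : 2 * (fb * fc) * wa = fc * (fa * wb + fb * wa) + fb * (fa * wc + fc * wa)
  - fa * (fb * wc + fc * wb) by ring.
rewrite ab ac bc !mulr0 subr0 addr0 => /eqP; rewrite !mulf_eq0 (negPf fb0) (negPf fc0).
by rewrite pnatr_eq0 => /eqP.
Qed.

Section UnitKillingGraph.
Variables (R : realType) (m : nat).
Local Notation V := 'rV[R]_m.
Implicit Types (B : set V) (e a b c d h u v p : V) (tau : V -> R) (G : V -> V).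

Definition graph_lift e tau v h : V := v + 'D_v tau h *: e.

(* A unit Killing field [G] along the graph of [tau] over displacements transverse to [e], both
   read as functions of the displacement: they are constant along [e] except that sliding the base
   point by [e] lowers the height [tau] by one. *)
Record unit_killing_graph B e tau G : Prop := UnitKillingGraph {
  graph_smooth : smooth_on B tau;
  field_smooth : smooth_on B G;
  graph_vertical : forall h, B h -> 'D_e tau h = -1;
  field_vertical : forall h, B h -> 'D_e G h = 0;
  field_killing : forall h v, B h -> dot (graph_lift e tau v h) ('D_v G h) = 0;
  field_tangent : forall h, B h -> 'D_(G h) tau h = 0;
  field_unit : forall h, B h -> dot (G h) (G h) = 1
}.

Variables (B : set V) (e : V) (tau : V -> R) (G : V -> V).
Hypothesis kg : unit_killing_graph B e tau G.

Let stau : smooth_on B tau := graph_smooth kg.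
Let sG : smooth_on B G := field_smooth kg.
Let oB : open B := smooth_open sG.
Local Notation lift := (graph_lift e tau).
Local Notation z a := (fun h => dot a (G h)).
Local Notation w := (fun h => dot e (G h)).

Lemma smooth_component a : smooth_on B (z a).
Proof.
by apply: smooth_dot sG; apply/(smooth_rowP _ oB) => i; exact: smooth_cst.
Qed.

Lemma derive_component a v h : B h -> 'D_v (z a) h = dot a ('D_v G h).
Proof.
move=> Bh; have [_] := is_derive_dot (is_derive_cst a h v) (smooth_is_derive v sG Bh).
by rewrite dot0l addr0.
Qed.

(* the skew matrix extending the derivative of the field from the tangent space *)
Definition gradmx h : 'M[R]_m := \matrix_i ('D_('e_i) G h + 'D_('e_i) tau h *: gradient w h).

Lemma mul_gradmx b h : B h -> b *m gradmx h = 'D_b G h + 'D_b tau h *: gradient w h.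
Proof.
move=> Bh; apply/rowP => j; rewrite mulmx_sum_row summxE.
rewrite mxE [in RHS]mxE (derive_coord j (smooth_derivable b sG Bh)).
rewrite -(dot_gradient _ (smooth_row j sG) Bh) -(dot_gradient _ stau Bh).
rewrite /dot mulr_suml -big_split; apply: eq_bigr => i _ /=.
rewrite rowK !mxE (derive_coord j (smooth_derivable _ sG Bh)).
by move: ('D_ _ _ _) ('D_ _ _ _) ('D_ _ _ _) => x y t; ring.
Qed.

Lemma dot_gradmx a b h : B h ->
  dot (b *m gradmx h) a = 'D_b (z a) h + 'D_b tau h * 'D_a w h.
Proof.
move=> Bh; rewrite mul_gradmx// dotDl dotZl (dot_gradient _ (smooth_component e) Bh).
by rewrite (derive_component a b Bh) [dot a _]dotC.
Qed.

Lemma lift_gradmx v h : B h -> lift v h *m gradmx h = 'D_v G h.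
Proof.
move=> Bh; have egrad : e *m gradmx h = - gradient w h.
  by rewrite mul_gradmx// (field_vertical kg Bh) (graph_vertical kg Bh) add0r scaleN1r.
by rewrite /graph_lift mulmxDl -scalemxAl egrad mul_gradmx// scalerN addrK.
Qed.

Lemma gradmx_skew h : B h -> (gradmx h)^T = - gradmx h.
Proof.
move=> Bh; apply/skewP => v; rewrite dot_gradmx// !derive_component//.
by rewrite -dotZl -dotDl; exact: (field_killing kg).
Qed.

Lemma smooth_dot_gradmx a b : smooth_on B (fun h => dot (b *m gradmx h) a).
Proof.
apply: (@smooth_eq _ _ _ (fun h => 'D_b (z a) h + 'D_b tau h * 'D_a w h)) => [h|].
  by rewrite inE => /dot_gradmx ->.
apply: smooth_add (smooth_derive _ (smooth_component _)) _.
exact: smooth_mul (smooth_derive _ stau) (smooth_derive _ (smooth_component _)).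
Qed.

Lemma gradmx_coord i j h : gradmx h i j = dot ('e_i *m gradmx h) 'e_j.
Proof. by rewrite -rowE dotC dot_delta [RHS]mxE. Qed.

Lemma smooth_gradmx i j : smooth_on B (fun h => gradmx h i j).
Proof.
have -> : (fun h => gradmx h i j) = (fun h => dot ('e_i *m gradmx h) 'e_j).
  by apply/funext => h; exact: gradmx_coord.
exact: smooth_dot_gradmx.
Qed.

Lemma derive_dot_gradmx a b c h : B h -> 'D_c (fun h => dot (b *m gradmx h) a) h =
  'D_c ('D_b (z a)) h + ('D_b tau h * 'D_c ('D_a w) h + 'D_a w h * 'D_c ('D_b tau) h).
Proof.
move=> Bh; have sz := smooth_derive b (smooth_component a).
have st := smooth_derive b stau; have sw := smooth_derive a (smooth_component e).
transitivity ('D_c (fun h => 'D_b (z a) h + 'D_b tau h * 'D_a w h) h).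
  by apply: near_eq_derive; apply: filterS (near_smooth sG Bh) => k; exact: dot_gradmx.
rewrite (derive_funD (smooth_derivable c sz Bh) (smooth_derivable c (smooth_mul st sw) Bh)).
by rewrite (derive_funM (smooth_derivable c st Bh) (smooth_derivable c sw Bh)).
Qed.

(* The defect of the identity is symmetric in [b] and [c] because derivatives commute, and skew
   in [a] and [b] by differentiating the Killing equation. *)
Lemma second_derive_component a b c h : B h ->
  'D_c ('D_b (z a)) h + ('D_a w h * 'D_c ('D_b tau) h + 'D_a tau h * 'D_c ('D_b w) h) = 0.
Proof.
move=> Bh; move: a b c; apply: skew_symmetric_eq0 => a b c.
  rewrite (derive_comm c b (smooth_component a) Bh) (derive_comm c b stau Bh).
  by rewrite (derive_comm c b (smooth_component e) Bh).
have skew0 : 'D_c (fun h => dot (b *m gradmx h) a) h + 'D_c (fun h => dot (a *m gradmx h) b) h = 0.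
  have dg x y := smooth_derivable c (smooth_dot_gradmx x y) Bh.
  rewrite -(derive_funD (dg a b) (dg b a)).
  rewrite -[RHS](derive_cst (0 : R) h c); apply: near_eq_derive.
  apply: filterS (near_smooth sG Bh) => k Bk.
  by rewrite dot_skew ?gradmx_skew// [dot b _]dotC addNr.
apply/eqP; rewrite -addr_eq0 -[X in _ == X]skew0.
rewrite (derive_dot_gradmx a b c Bh) (derive_dot_gradmx b a c Bh).
move: ('D_c ('D_b (z a)) h) ('D_c ('D_a (z b)) h) ('D_c ('D_b tau) h) ('D_c ('D_a tau) h).
move: ('D_c ('D_b w) h) ('D_c ('D_a w) h) ('D_a tau h) ('D_b tau h) ('D_a w h) ('D_b w h).
by move=> *; apply/eqP; ring.
Qed.

Lemma derive_gradmx a b c h : B h -> 'D_c (fun h => dot (b *m gradmx h) a) h =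
  'D_b tau h * 'D_c ('D_a w) h - 'D_a tau h * 'D_c ('D_b w) h.
Proof.
move=> Bh; rewrite derive_dot_gradmx//; have := second_derive_component a b c Bh.
move: ('D_c ('D_b (z a)) h) ('D_c ('D_b tau) h) ('D_c ('D_a w) h) ('D_c ('D_b w) h).
by move: ('D_a w h) ('D_b tau h) ('D_a tau h) => *; lra.
Qed.

Lemma gauss_equation a b c d h : B h ->
  'D_d ('D_b tau) h * 'D_c ('D_a w) h - 'D_d ('D_a tau) h * 'D_c ('D_b w) h =
  'D_c ('D_b tau) h * 'D_d ('D_a w) h - 'D_c ('D_a tau) h * 'D_d ('D_b w) h.
Proof.
move=> Bh; have sw := smooth_component e.
have third x y : 'D_y ('D_x (fun h => dot (b *m gradmx h) a)) h =
    'D_b tau h * 'D_y ('D_x ('D_a w)) h + 'D_x ('D_a w) h * 'D_y ('D_b tau) h -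
    ('D_a tau h * 'D_y ('D_x ('D_b w)) h + 'D_x ('D_b w) h * 'D_y ('D_a tau) h).
  have sDtau v := smooth_derive v stau.
  have sDDw v := smooth_derive x (smooth_derive v sw).
  transitivity ('D_y (fun h => 'D_b tau h * 'D_x ('D_a w) h - 'D_a tau h * 'D_x ('D_b w) h) h).
    by apply: near_eq_derive; apply: filterS (near_smooth sG Bh) => k; exact: derive_gradmx.
  have dm u v := smooth_derivable y (smooth_mul (sDtau u) (sDDw v)) Bh.
  have dt v := smooth_derivable y (sDtau v) Bh.
  have dw v := smooth_derivable y (sDDw v) Bh.
  apply: etrans (derive_funB (dm b a) (dm a b)) _; congr (_ - _).
    exact: derive_funM (dt b) (dw a).
  exact: derive_funM (dt a) (dw b).
have third_comm : 'D_c ('D_d (fun h => dot (b *m gradmx h) a)) h = _ :=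
  etrans (derive_comm c d (smooth_dot_gradmx a b) Bh) (third c d).
have cancel_third (tb ta wadc wacd wbdc wbcd sbc sac sbd sad wac wad wbc wbd : R) :
    wadc = wacd -> wbdc = wbcd ->
    tb * wadc + wad * sbc - (ta * wbdc + wbd * sac) =
      tb * wacd + wac * sbd - (ta * wbcd + wbc * sad) ->
    sbd * wac - sad * wbc = sbc * wad - sac * wbd.
  move=> -> -> third_eq; have -> : sbd * wac - sad * wbc =
    tb * wacd + wac * sbd - (ta * wbcd + wbc * sad) - tb * wacd + ta * wbcd by ring.
  by rewrite -third_eq; ring.
exact: cancel_third (derive_comm c d (smooth_derive a sw) Bh)
  (derive_comm c d (smooth_derive b sw) Bh) (etrans (esym (third d c)) third_comm).
Qed.

Lemma dot_field_derive v h : B h -> dot (G h) ('D_v G h) = 0.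
Proof.
move=> Bh; have dG := smooth_is_derive v sG Bh; have [_] := is_derive_dot dG dG.
rewrite [X in _ + X]dotC -mulr2n -mulr_natl (_ : 'D_v _ h = 0) => [/esym/eqP|].
  by rewrite mulf_eq0 pnatr_eq0 /= => /eqP.
rewrite -[RHS](derive_cst (1 : R) h v); apply: near_eq_derive.
by apply: filterS (near_smooth sG Bh) => k; exact: (field_unit kg).
Qed.

Lemma gram_derive a b h : B h ->
  dot ('D_a G h) ('D_b G h) = 'D_b ('D_a tau) h * 'D_(G h) w h.
Proof.
move=> Bh; have sDG := smooth_derive a sG.
have [_] := is_derive_dot (smooth_is_derive b sG Bh) (smooth_is_derive b sDG Bh).
rewrite (_ : 'D_b _ h = 0) => [|]; last first.
  rewrite -[RHS](derive_cst (0 : R) h b); apply: near_eq_derive.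
  by apply: filterS (near_smooth sG Bh) => k; exact: dot_field_derive.
have -> : dot (G h) ('D_b ('D_a G) h) = 'D_b ('D_a (z (G h))) h.
  have [_ dDG] := is_derive_dot (is_derive_cst (G h) h b) (smooth_is_derive b sDG Bh).
  rewrite dot0l addr0 in dDG; rewrite -dDG; apply: near_eq_derive.
  by apply: filterS (near_smooth sG Bh) => k Bk; rewrite derive_component.
have /eqP := second_derive_component (G h) a b Bh.
rewrite (field_tangent kg Bh) mul0r addr0 addr_eq0 => /eqP -> /esym/eqP.
by rewrite addrC subr_eq0 dotC => /eqP ->; exact: mulrC.
Qed.

Lemma tangent_vertical_eq0 v h : B h -> (v <= e)%MS -> 'D_v tau h = 0 -> v = 0.
Proof.
move=> Bh /sub_rVP[k ->]; rewrite (derive_dirZ _ _ stau Bh) (graph_vertical kg Bh) mulrN1.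
by move=> /eqP; rewrite oppr_eq0 => /eqP ->; rewrite scale0r.
Qed.

Lemma field_not_vertical h : B h -> ~~ (G h <= e)%MS.
Proof.
move=> Bh; apply/negP => /(tangent_vertical_eq0 Bh)/(_ (field_tangent kg Bh)).
by have /dot1_neq0/eqP := field_unit kg Bh; exact.
Qed.

Lemma lift_eq0_vertical v h : lift v h = 0 -> (v <= e)%MS.
Proof.
move=> /eqP; rewrite addr_eq0 -scaleNr => /eqP ->; apply/sub_rVP.
by exists (- 'D_v tau h).
Qed.

Lemma hessian_neq0 u h : B h -> gradmx h \in unitmx -> ~~ (u <= e)%MS ->
  'D_u ('D_u tau) h != 0.
Proof.
move=> Bh grad_unit; apply: contra => /eqP hess0; apply: (@lift_eq0_vertical _ h).
rewrite -[lift u h](mulmxK grad_unit) lift_gradmx//.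
have /eqP := gram_derive u u Bh; rewrite hess0 mul0r dot_eq0 => /eqP ->.
by rewrite mul0mx.
Qed.

Lemma orthogonal_not_vertical b : dot b b = 1 -> dot e b = 0 -> ~~ (b <= e)%MS.
Proof.
move=> b1 eb; apply/negP => /sub_rVP[k bE].
by have := b1; rewrite {1}bE dotZl eb mulr0 => /esym/eqP; rewrite oner_eq0.
Qed.

Lemma gauss_orthogonal u v h : B h -> 'D_v ('D_u tau) h = 0 ->
  'D_u ('D_u tau) h * 'D_v ('D_v w) h + 'D_v ('D_v tau) h * 'D_u ('D_u w) h = 0.
Proof.
move=> Bh uv; have vu := etrans (derive_comm u v stau Bh) uv.
have drop_mixed (tuv tvu tuu tvv wuv wvu wuu wvv : R) : tuv = 0 -> tvu = 0 ->
    tuv * wuv - tvv * wuu = tuu * wvv - tvu * wvu -> tuu * wvv + tvv * wuu = 0.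
  by move=> -> ->; rewrite !mul0r sub0r subr0 => <-; rewrite addNr.
exact: drop_mixed uv vu (gauss_equation v u u v Bh).
Qed.

(* Three mutually conjugate directions force the Hessian of [w] to vanish: this is where the
   dimension of the hypersurface must be at least three. *)
Lemma component_hessian_diag0 a h : (4 <= m)%N -> B h -> gradmx h \in unitmx ->
  'D_a ('D_a w) h = 0.
Proof.
move=> m4 Bh grad_unit; have sw := smooth_component e.
have [/sub_rVP[k ->]|a_e] := boolP (a <= e)%MS.
  rewrite (derive_dirZ _ _ (smooth_derive _ sw) Bh).
  rewrite (_ : 'D_e ('D_(k *: e) w) h = 0) ?mulr0//.
  rewrite (derive_comm _ _ sw Bh) (derive_dirZ _ _ (smooth_derive _ sw) Bh).
  rewrite (_ : 'D_e ('D_e w) h = 0) ?mulr0//.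
  rewrite -[RHS](derive_cst (0 : R) h e); apply: near_eq_derive.
  apply: filterS (near_smooth sG Bh) => y By.
  by rewrite derive_component// (field_vertical kg By) dot0r.
pose row_hess u := gradient ('D_u tau) h.
have conjugate u v : dot (row_hess u) v = 0 -> 'D_v ('D_u tau) h = 0.
  by rewrite (dot_gradient _ (smooth_derive u stau) Bh).
have [b b1 [eb ab _]] := exists_orthogonal3 e (row_hess a) 0 m4.
have [c c1 [ec ac bc]] := exists_orthogonal3 e (row_hess a) (row_hess b) m4.
have b_e := orthogonal_not_vertical b1 eb; have c_e := orthogonal_not_vertical c1 ec.
exact: cross_sums_eq0 (hessian_neq0 Bh grad_unit b_e) (hessian_neq0 Bh grad_unit c_e)
  (gauss_orthogonal Bh (conjugate a b ab)) (gauss_orthogonal Bh (conjugate a c ac))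
  (gauss_orthogonal Bh (conjugate b c bc)).
Qed.

Lemma component_hessian0 a b h : (4 <= m)%N -> B h -> gradmx h \in unitmx ->
  'D_b ('D_a w) h = 0.
Proof.
move=> m4 Bh grad_unit; have sw := smooth_component e.
have diag v := component_hessian_diag0 v m4 Bh grad_unit.
have hessD u v x : 'D_x ('D_(u + v) w) h = 'D_x ('D_u w) h + 'D_x ('D_v w) h.
  apply: etrans (derive_comm x (u + v) sw Bh) _.
  apply: etrans (derive_dirD u v (smooth_derive x sw) Bh) _.
  exact: (f_equal2 (@GRing.add R) (derive_comm u x sw Bh) (derive_comm v x sw Bh)).
have polar : 'D_(a + b) ('D_(a + b) w) h = 'D_a ('D_a w) h + 'D_a ('D_b w) h +
    ('D_b ('D_a w) h + 'D_b ('D_b w) h).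
  apply: etrans (derive_dirD a b (smooth_derive (a + b) sw) Bh) _.
  exact: (f_equal2 (@GRing.add R) (hessD a b a) (hessD a b b)).
have polar_eq0 (q aa ab ba bb : R) :
    q = 0 -> aa = 0 -> bb = 0 -> ab = ba -> q = aa + ab + (ba + bb) -> ba = 0.
  move=> -> -> -> ->; rewrite add0r addr0 -mulr2n => /esym/eqP.
  by rewrite mulrn_eq0 /= => /eqP.
exact: polar_eq0 (diag (a + b)) (diag a) (diag b) (derive_comm a b sw Bh) polar.
Qed.

Lemma gradmx_near_cst h : (4 <= m)%N -> B h -> gradmx h \in unitmx ->
  \forall k \near h, gradmx k = gradmx h.
Proof.
move=> m4 Bh grad_unit.
have cdet : {for h, continuous (fun k => \det (gradmx k))}.
  by apply: continuous_det => i j; exact: smooth_continuous (smooth_gradmx i j) Bh.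
have det_near : \forall k \near h, \det (gradmx k) != 0.
  by apply: (cvgr_neq0 _ cdet); rewrite -unitfE -unitmxE.
have entry_cst (i j : 'I_m) : \forall k \near h, gradmx k i j = gradmx h i j.
  apply: (@near_derive0_cst _ _ (fun k => gradmx k i j)).
  apply: filterS2 (near_smooth sG Bh) det_near => k Bk det_k v.
  have unit_k : gradmx k \in unitmx by rewrite unitmxE unitfE.
  have <- : 'D_v (fun k => gradmx k i j) k = 0.
    have -> : (fun k => gradmx k i j) = (fun k => dot ('e_i *m gradmx k) 'e_j).
      by apply/funext => x; exact: gradmx_coord.
    by rewrite derive_gradmx// !component_hessian0// !mulr0 subrr.
  exact: smooth_is_derive (smooth_gradmx i j) Bk.
have : \forall k \near h, forall i j, gradmx k i j = gradmx h i j.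
  apply: (@filter_forall _ _ _ _ (nbhs_filter h)) => i.
  by apply: (@filter_forall _ _ _ _ (nbhs_filter h)) => j; exact: entry_cst.
by apply: filterS => k gradE; apply/matrixP.
Qed.

Lemma is_derive_graph_lift p v h : B h ->
  is_derive h v (graph_point p e tau) (lift v h).
Proof. by move=> Bh; apply/is_derive_graph_point/(smooth_is_derive v stau). Qed.

Lemma local_rigidity p h : (4 <= m)%N -> B h -> gradmx h \in unitmx -> \forall k \near h,
  G k = G h + (graph_point p e tau k - graph_point p e tau h) *m gradmx h.
Proof.
move=> m4 Bh grad_unit; set A := gradmx h; pose psi := graph_point p e tau.
have near_cst : \forall k \near h, G k - psi k *m A = G h - psi h *m A.
  apply: (@near_derive0_cst_row _ _ _ (fun k => G k - psi k *m A)).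
  apply: filterS2 (near_smooth sG Bh) (gradmx_near_cst m4 Bh grad_unit) => k Bk gradE v.
  rewrite -(subrr ('D_v G k)) -[in X in _ - X](lift_gradmx v Bk) gradE.
  apply: is_deriveB (smooth_is_derive v sG Bk) _.
  exact: is_derive_mulmx (is_derive_graph_lift p v Bk).
apply: filterS near_cst => k /eqP; rewrite subr_eq => /eqP ->.
by rewrite mulmxBl addrAC addrA.
Qed.

Lemma gradmx_affine A p c h : B h -> A^T = - A ->
  (\forall k \near h, G k = graph_point p e tau k *m A + c) -> gradmx h = A.
Proof.
move=> Bh skA affine; pose D := gradmx h - A.
have skD : D^T = - D by rewrite linearB /= gradmx_skew// skA opprB opprK addrC.
have DG b : 'D_b G h = lift b h *m A.
  have := is_derive_mulmx A (is_derive_graph_lift p b Bh).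
  move=> /(is_deriveD (is_derive_cst c h b))[_]; rewrite add0r => <-.
  by apply: near_eq_derive; apply: filterS affine => k ->; rewrite addrC.
have bD b : b *m D = (- 'D_b tau h) *: (e *m D).
  have /eqP : lift b h *m D = 0 by rewrite mulmxBr lift_gradmx// DG subrr.
  by rewrite /graph_lift mulmxDl -scalemxAl addr_eq0 -scaleNr => /eqP.
have eD : e *m D = 0.
  by apply: dot_ext => a; rewrite dotC dot_skew// bD dotZr dotC dot_skew0// mulr0 oppr0 dot0r.
apply/eqP; rewrite -subr_eq0 -/D; apply/eqP/row_matrixP => i.
by rewrite row0 rowE bD eD scaler0.
Qed.

End UnitKillingGraph.

Section DefiniteHessian.
Variables (R : realType) (m : nat).
Local Notation V := 'rV[R]_m.
Variables (B : set V) (e : V) (tau : V -> R) (G : V -> V) (h : V).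
Hypothesis kg : unit_killing_graph B e tau G.
Hypothesis Bh : B h.
Hypothesis anisotropic : forall v, ~~ (v <= e)%MS -> 'D_v ('D_v tau) h != 0.
Implicit Types (u v k : V).

Let stau : smooth_on B tau := graph_smooth kg.
Let sG : smooth_on B G := field_smooth kg.
Local Notation w := (fun h => dot e (G h)).
Local Notation lift := (graph_lift e tau).

Lemma field_component_derive_neq0 : 'D_(G h) w h != 0.
Proof.
apply/eqP => Dw0; have DG0 v : 'D_v G h = 0.
  by apply/eqP; rewrite -dot_eq0 (gram_derive kg _ _ Bh) Dw0 mulr0.
have := anisotropic (field_not_vertical kg Bh); apply/negP/negPn.
have [_] := is_derive_dot (is_derive_gradient (G h) stau Bh) (smooth_is_derive (G h) sG Bh).
rewrite DG0 dot0r add0r (dot_gradient _ (smooth_derive _ stau) Bh) => <-.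
rewrite -[X in _ == X](derive_cst (0 : R) h (G h)); apply/eqP/near_eq_derive.
apply: filterS (near_smooth sG Bh) => k Bk.
by rewrite (dot_gradient _ stau Bk) (field_tangent kg Bk).
Qed.

Lemma gradmx_unit : gradmx e tau G h \in unitmx.
Proof.
have Dw0 := field_component_derive_neq0.
have vertical u : 'D_u G h = 0 -> (u <= e)%MS.
  move=> Du0; have /esym/eqP := gram_derive kg u u Bh.
  by rewrite Du0 dot0l mulf_eq0 (negPf Dw0) orbF; apply: contraLR; exact: anisotropic.
set A := gradmx e tau G h; have skA : A^T = - A := gradmx_skew kg Bh.
pose N := G h *m A.
have N_lift v : dot N (lift v h) = 0.
  by rewrite /N dot_skew// (lift_gradmx kg v Bh) (dot_field_derive kg v Bh) oppr0.
have N_e : dot N e != 0.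
  apply/eqP => Ne0; suff GE : G h *m A = 0.
    have := field_not_vertical kg Bh; rewrite vertical//.
    by rewrite -(lift_gradmx kg _ Bh) /graph_lift (field_tangent kg Bh) scale0r addr0.
  apply: dot_ext => v; rewrite dot0r dotC.
  by have := N_lift v; rewrite /graph_lift dotDr dotZr Ne0 mulr0 addr0.
rewrite -row_free_unit; apply: inj_row_free => k kA.
have slope0 : 'D_k tau h = 0.
  have := N_lift k; rewrite /graph_lift dotDr dotZr [dot N k]dot_skew// kA dot0r oppr0 add0r.
  by move=> /eqP; rewrite mulf_eq0 (negPf N_e) orbF => /eqP.
apply: (tangent_vertical_eq0 kg Bh _ slope0); apply: vertical.
by rewrite -(lift_gradmx kg _ Bh) /graph_lift slope0 scale0r addr0.
Qed.

End DefiniteHessian.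

Section FarthestPoint.
Variables (R : realType) (m : nat).
Local Notation V := 'rV[R]_m.
Implicit Types (e p h v : V) (tau : V -> R).

Lemma farthest_hessian (B : set V) e tau p h v : smooth_on B tau -> B h ->
  (\forall k \near h, dot (graph_point p e tau k) (graph_point p e tau k) <=
    dot (graph_point p e tau h) (graph_point p e tau h)) ->
  ~~ (v <= e)%MS -> 'D_v ('D_v tau) h != 0.
Proof.
move=> stau Bh far; apply: contra => /eqP hess0; apply: (@lift_eq0_vertical _ _ _ tau _ h).
pose psi := graph_point p e tau; pose lift := graph_lift e tau v.
have dpsi k : B k -> is_derive k v psi (lift k).
  by move=> Bk; apply/is_derive_graph_point/(smooth_is_derive v stau Bk).
have dsq k : B k -> is_derive k v (fun k => dot (psi k) (psi k)) (2 * dot (psi k) (lift k)).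
  move=> /dpsi dk; have [dd Dd] := is_derive_dot dk dk.
  by split=> //; rewrite Dd [X in _ + X]dotC mulr_natl mulr2n.
have dlift : is_derive h v lift 0.
  have := smooth_is_derive v (smooth_derive v stau) Bh; rewrite hess0.
  move=> /(is_derive_scaler e)/(is_deriveD (is_derive_cst v h v)).
  by rewrite scale0r addr0.
pose f (t : R) := dot (psi (h + t *: v)) (psi (h + t *: v)).
pose f' (t : R) := 2 * dot (psi (h + t *: v)) (lift (h + t *: v)).
have df : \forall t \near (0 : R), is_derive t (1 : R) f (f' t).
  have : \forall t \near (0 : R), B (h + t *: v) by exact: line_cvg (near_smooth stau Bh).
  by apply: filterS => t /dsq[dt Dt]; have := is_derive_line dt; rewrite Dt.
have df' : is_derive (0 : R) (1 : R) f' (2 * dot (lift h) (lift h)).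
  have [dpl Dpl] := is_deriveM (is_derive_cst (2 : R) h v) (is_derive_dot (dpsi h Bh) dlift).
  by have := is_derive_line0 dpl; rewrite Dpl scaler0 addr0 dot0r add0r.
have fmax : \forall t \near (0 : R), f t <= f 0.
  by rewrite /f scale0r addr0; exact: line_cvg far.
apply/eqP; rewrite -dot_eq0 eq_le dot_ge0 andbT -(@pmulr_rle0 _ 2)//.
exact: second_derive_max df df' fmax.
Qed.

End FarthestPoint.

(** * The field is affine *)

Section KillingChart.
Variables (R : realType) (m : nat).
Local Notation V := 'rV[R]_m.
Variables (M : set V) (xi : V -> V).
Implicit Types (B : set V) (e h p v y : V) (tau : V -> R).

Definition killing_chart p B e tau :=
  [/\ B 0, forall h, B h -> M (graph_point p e tau h),
      forall h, B h -> M (p + h) -> tau h = 0 &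
      unit_killing_graph B e tau (xi \o graph_point p e tau)].

Lemma killing_chart_exists p : hypersurface M -> killing M xi ->
  (forall y, M y -> dot (xi y) (xi y) = 1) -> M p ->
  exists B e tau, killing_chart p B e tau.
Proof.
move=> hM [[sxi xiT] [Phi [flow iso]]] unit_xi Mp.
have [U1 [phi [e [U1p fr1]]]] := hypersurface_frame hM Mp.
have [U2 [F [U2p [sF F_xi]]]] := sxi p Mp.
have oU : open (U1 `&` U2) by apply: openI; [case: fr1 => /smooth_open | exact: smooth_open sF].
have fr := defining_frame_sub oU (@subIsetl _ _ _) fr1.
have [B [tau [B0 stau psiMU tau0 dtau]]] := graph_chart fr Mp (conj U1p U2p).
have [psiU psiM] : (forall h, B h -> (U1 `&` U2) (graph_point p e tau h)) /\
  (forall h, B h -> M (graph_point p e tau h)) by split=> h /psiMU[].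
have psiF h : B h -> F (graph_point p e tau h) = xi (graph_point p e tau h).
  by move=> Bh; apply: F_xi; [exact: psiM | have [] := psiU h Bh].
have liftE v h : B h -> graph_lift e tau v h = lift phi e v (graph_point p e tau h).
  by move=> Bh; have [_ Dtau] := dtau h v Bh; rewrite /graph_lift Dtau.
have dG v h : B h -> is_derive h v (xi \o graph_point p e tau)
    ('D_(graph_lift e tau v h) F (graph_point p e tau h)).
  move=> Bh; have dpsi := is_derive_graph_point p e (smooth_is_derive v stau Bh).
  apply: near_eq_is_derive (is_derive_comp_row sF (psiU h Bh).2 dpsi).
  by apply: filterS (near_smooth stau Bh) => k /psiF.
exists B, e, tau; split=> //; split=> //.
- apply/(smooth_rowP _ (smooth_open stau)) => i.
  have sFpsi := smooth_comp_row sF (smooth_graph_point p e stau) (fun h Bh => (psiU h Bh).2).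
  by apply: smooth_eq (smooth_row i sFpsi) => h; rewrite inE => /psiF ->.
- by move=> h Bh; have [_ ->] := dtau h e Bh; exact: (slope_e fr (psiU h Bh)).
- move=> h Bh; have [_ ->] := dG e h Bh; rewrite liftE// /lift (slope_e fr (psiU h Bh)).
  by rewrite scaleN1r subrr derive0.
- move=> h v Bh; have [_ ->] := dG v h Bh; rewrite liftE//.
  apply: (killing_equation flow iso unit_xi (psiM h Bh)).
    exact: tangent_lift fr (psiU h Bh) (psiM h Bh).
  by split; [exact: (psiU h Bh).2 | split].
- move=> h Bh; have [_ ->] := dtau h (xi (graph_point p e tau h)) Bh; apply: slope_tangent.
  by apply/(frame_tangentP _ fr (psiU h Bh) (psiM h Bh))/xiT/psiM.
- by move=> h /psiM/unit_xi.
Qed.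

Section Chart.
Variables (p : V) (B : set V) (e : V) (tau : V -> R).
Hypothesis Mp : M p.
Hypothesis kc : killing_chart p B e tau.
Local Notation psi := (graph_point p e tau).
Local Notation grad := (gradmx e tau (xi \o psi)).

Let B0 : B 0. Proof. by case: kc. Qed.
Let kg : unit_killing_graph B e tau (xi \o psi). Proof. by case: kc. Qed.
Let oB : open B. Proof. exact: smooth_open (graph_smooth kg). Qed.

Lemma chart_displacement y : M y -> B (y - p) -> psi (y - p) = y.
Proof.
move=> My By; have [_ _ tau0 _] := kc; rewrite /graph_point subrKC tau0 ?subrKC//.
by rewrite scale0r addr0.
Qed.

Lemma chart_center : psi 0 = p.
Proof. by have := chart_displacement Mp; rewrite subrr; exact. Qed.

Lemma near_displacement (A : set V) :
  (\forall h \near (0 : V), A h) -> \forall y \near p, A (y - p).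
Proof.
rewrite (near_shift p); have -> // : A \o shift (0 - p) = fun y => A (y - p).
by apply/funext => y; rewrite /= sub0r.
Qed.

Lemma chart_rigidity : (4 <= m)%N -> grad 0 \in unitmx ->
  \forall y \near p, M y -> xi y = xi p + (y - p) *m grad 0.
Proof.
move=> m4 grad_unit; have rigid := local_rigidity kg p m4 B0 grad_unit.
apply: filterS (near_displacement (filterI rigid (near_open oB B0))) => y [+ By] My.
by rewrite /= (chart_displacement My By) chart_center.
Qed.

Lemma chart_grad_affine (A : 'M[R]_m) c h : A^T = - A -> B h ->
  (\forall y \near psi h, M y -> xi y = y *m A + c) -> grad h = A.
Proof.
move=> skA Bh affine; apply: (gradmx_affine (p := p) (c := c) kg Bh skA).
have cpsi := smooth_continuous (smooth_graph_point p e (graph_smooth kg)) Bh.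
have affine_psi : \forall k \near h, M (psi k) -> xi (psi k) = psi k *m A + c.
  exact: cpsi _ affine.
by apply: filterS2 (near_open oB Bh) affine_psi => k Bk; apply; case: kc => _ + _ _; apply.
Qed.

Lemma chart_grad_closure (A : 'M[R]_m) c : A^T = - A ->
  closure (M `&` interior [set y | M y -> xi y = y *m A + c]) p -> grad 0 = A.
Proof.
move=> skA clp; apply/matrixP => i j.
apply: (@continuous_eq_of_near R _ R (fun h => grad h i j) (fun=> A i j) 0).
- exact: smooth_continuous (smooth_gradmx kg i j) B0.
- exact: cst_continuous.
move=> N nN; have := clp _ (near_displacement (filterI nN (near_open oB B0))).
move=> [y [[My affine] [Ny By]]]; exists (y - p), (y - p); split=> //.
by rewrite (chart_grad_affine (A := A) (c := c)) ?chart_displacement.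
Qed.

Lemma chart_grad_farthest : (forall y, M y -> dot y y <= dot p p) -> grad 0 \in unitmx.
Proof.
move=> far; apply: gradmx_unit kg B0 _ => v.
apply: (farthest_hessian (p := p) (graph_smooth kg) B0).
apply: filterS (near_open oB B0) => k Bk; rewrite chart_center.
by apply: far; case: kc => _ + _ _; apply.
Qed.

End Chart.

Lemma affine_unit_killing : (4 <= m)%N -> hypersurface M -> compact M -> connected M ->
  M !=set0 -> killing M xi -> (forall y, M y -> dot (xi y) (xi y) = 1) ->
  exists A c, [/\ A^T = - A, A \in unitmx & forall y, M y -> xi y = y *m A + c].
Proof.
move=> m4 hM cM conM M0 kM unit_xi.
have [p pM pmax] : exists2 p, p \in M & forall y, y \in M -> dot y y <= dot p p.
  apply: EVT_max_rV => //; apply: continuous_subspaceT => y.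
  by apply: (@continuous_dot _ _ V id id); exact: cvg_id.
have Mp : M p by rewrite inE in pM.
have [B [e [tau kc]]] := killing_chart_exists hM kM unit_xi Mp.
set A := gradmx e tau (xi \o graph_point p e tau) 0.
have A_unit : A \in unitmx.
  by apply: chart_grad_farthest kc _ => // y My; apply: pmax; rewrite inE.
have skA : A^T = - A by have [B0 _ _ kg] := kc; exact: (gradmx_skew kg B0).
pose c := xi p - p *m A; pose C := interior [set y | M y -> xi y = y *m A + c].
have affine_near q (q_c : xi q = q *m A + c) : (\forall y \near q,
    M y -> xi y = xi q + (y - q) *m A) -> C q.
  apply: filterS => y /[apply] ->.
  by rewrite q_c mulmxBl addrC addrA subrK.
exists A, c; split=> // y My; suff : (M `&` C) y by move=> [_ /interior_subset]; apply.
suff -> : M `&` C = M by [].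
apply: conM.
- exists p; split=> //; apply: affine_near; first by rewrite /c subrKC.
  exact: chart_rigidity Mp kc m4 A_unit.
- by exists C; [exact: open_interior |].
exists (closure (M `&` C)); first exact: closed_closure.
apply/seteqP; split=> [x MCx|x [Mx clx]]; first by split; [case: MCx | exact: subset_closure].
split=> //; have [Bx [ex [taux kcx]]] := killing_chart_exists hM kM unit_xi Mx.
have gradE := chart_grad_closure kcx skA clx.
have rigid := chart_rigidity Mx kcx m4; rewrite gradE in rigid.
have [y' [[My' /interior_subset/(_ My') y'_c] /(_ My') y'_x]] := clx _ (rigid A_unit).
apply: affine_near (rigid A_unit).
move: y'_c; rewrite y'_x mulmxBl addrCA => /addrI/eqP; rewrite subr_eq => /eqP ->.
exact: addrC.
Qed.

End KillingChart.

(** * Normal form of a skew matrix *)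

Section SymmetricEigenvector.
Variables (R : realType) (m : nat).
Local Notation V := 'rV[R]_m.
Implicit Types (u w x : V) (A : 'M[R]_m).

Lemma quadratic_le0_linear_eq0 (a b : R) : (forall t : R, 2 * t * a + t ^+ 2 * b <= 0) -> a = 0.
Proof.
move=> quad_le0; apply/eqP/negPn/negP => a0.
pose s := (`|b| + 1)^-1; have s0 : 0 < s by rewrite invr_gt0 ltr_wpDl.
have sb : - 1 <= s * b.
  have : `|s * b| <= 1.
    by rewrite normrM gtr0_norm// mulrC ler_pdivrMr ?ltr_wpDl// mul1r lerDl.
  by rewrite ler_norml => /andP[].
have := quad_le0 (a * s); rewrite (_ : _ + _ = s * a ^+ 2 * (2 + s * b)); last by ring.
apply/negP; rewrite -ltNge mulr_gt0//; last by lra.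
by rewrite mulr_gt0// exprn_even_gt0.
Qed.

Lemma compact_unit_submx n (W : 'M[R]_(n, m)) :
  compact [set x : V | dot x x = 1 /\ (x <= W)%MS].
Proof.
apply: bounded_closed_compact.
  exists 1; split=> // c c1 x [x1 _] /=; apply: le_trans (ltW c1).
  by apply: norm_le_coord => // i; exact: coord_le1.
pose C := cokermx W; have sub_W x : (dot (x *m C) (x *m C) = 0) <-> (x <= W)%MS.
  by rewrite submxE -dot_eq0; split=> /eqP.
have -> : [set x : V | dot x x = 1 /\ (x <= W)%MS] =
    (fun x : V => dot x x) @^-1` [set 1] `&` (fun x => dot (x *m C) (x *m C)) @^-1` [set 0].
  by apply/seteqP; split=> x [x1 /sub_W xW].
apply: closedI; apply: preimage_closed; try exact: closed_eq.
  by move=> x _; apply: (@continuous_dot _ _ V id id); exact: cvg_id.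
by move=> x _; apply: (@continuous_dot _ _ V (mulmx^~ C) (mulmx^~ C));
  apply: (@continuous_mulmx _ _ _ C V id); exact: cvg_id.
Qed.

Lemma rayleigh_max n A (W : 'M[R]_(n, m)) : W != 0 -> exists u l,
  [/\ (u <= W)%MS, dot u u = 1, dot (u *m A) u = l &
      forall x, (x <= W)%MS -> dot (x *m A) x <= l * dot x x].
Proof.
move=> /rowV0Pn[y yW y0]; pose K := [set x : V | dot x x = 1 /\ (x <= W)%MS].
have K0 : K !=set0.
  by exists ((Num.sqrt (dot y y))^-1 *: y); split; [exact: normalize_dot1 | exact: scalemx_sub].
have cK : {within K, continuous (fun x : V => dot (x *m A) x)}.
  apply: continuous_subspaceT => x.
  apply: (@continuous_dot _ _ V (mulmx^~ A) id); last exact: cvg_id.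
  by apply: (@continuous_mulmx _ _ _ A V id); exact: cvg_id.
have [u] := EVT_max_rV K0 (compact_unit_submx (W := W)) cK; rewrite inE => -[u1 uW] umax.
exists u, (dot (u *m A) u); split=> // x xW.
have [->|x0] := eqVneq x 0; first by rewrite !dot0r mulr0.
have := umax ((Num.sqrt (dot x x))^-1 *: x); rewrite inE.
move=> /(_ (conj (normalize_dot1 x0) (scalemx_sub _ xW))).
rewrite -scalemxAl dotZl dotZr mulrA -expr2 exprVn sqr_sqrtr ?dot_ge0// mulrC.
by rewrite ler_pdivrMr ?dot_gt0.
Qed.

Lemma symmetric_eigenvector n A (W : 'M[R]_(n, m)) : A^T = A -> W != 0 -> stablemx W A ->
  exists u l, [/\ (u <= W)%MS, dot u u = 1 & u *m A = l *: u].
Proof.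
move=> symA W0 stabW; have [u [l [uW u1 ul max_l]]] := rayleigh_max A W0.
pose w := u *m A - l *: u.
have wW : (w <= W)%MS.
  by rewrite addmx_sub ?(submx_trans (submxMr A uW))// -scaleNr scalemx_sub.
have uw : dot u w = 0 by rewrite dotBr dotZr u1 mulr1 dotC ul subrr.
have uAw : dot (u *m A) w = dot w w.
  by rewrite -[u *m A](subrK (l *: u)) -/w dotDl dotZl uw mulr0 addr0.
exists u, l; split=> //; apply/eqP; rewrite -subr_eq0 -/w -dot_eq0 -uAw; apply/eqP.
move: (w) wW uw {uAw} => {}w wW uw.
apply: (@quadratic_le0_linear_eq0 _ (dot (w *m A) w - l * dot w w)) => t.
have := max_l (u + t *: w) (addmx_sub uW (scalemx_sub _ wW)).
rewrite mulmxDl -scalemxAl !(dotDl, dotDr, dotZl, dotZr) ul u1 uw [dot w u]dotC uw.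
have -> : dot (w *m A) u = dot (u *m A) w by rewrite dot_mulmxl symA dotC.
by rewrite -subr_le0; apply: le_trans; rewrite le_eqVlt; apply/orP; left; apply/eqP; ring.
Qed.

End SymmetricEigenvector.

Section SkewNormalForm.
Variables (R : realType) (m : nat).
Local Notation V := 'rV[R]_m.
Variable S : 'M[R]_m.
Hypothesis skS : S^T = - S.
Implicit Types (u : V) (v : nat -> V) (om : nat -> R).

Definition orthonormal_family k v :=
  forall i j, (i < k)%N -> (j < k)%N -> dot (v i) (v j) = (i == j)%:R.

(* pairs [v (2 l), v (2 l).+1] spanning orthogonal planes that [S] rotates with frequency [om l] *)
Definition skew_family k v om := orthonormal_family (2 * k) v /\
  forall l, (l < k)%N -> [/\ om l != 0, v (2 * l)%N *m S = om l *: v (2 * l).+1 &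
     v (2 * l).+1 *m S = (- om l) *: v (2 * l)%N].

Lemma orthonormal_family_extend k v u : orthonormal_family k v -> dot u u = 1 ->
  (forall i, (i < k)%N -> dot (v i) u = 0) -> orthonormal_family k.+1 [eta v with k |-> u].
Proof.
move=> orth u1 vu i j; rewrite !ltnS /= => ik jk.
case: (eqVneq i k) ik => [->|ik]; case: (eqVneq j k) jk => [->|jk] /=.
- by rewrite u1.
- by rewrite leq_eqVlt (negPf jk) dotC => /vu ->.
- by rewrite [(i <= k)%N]leq_eqVlt (negPf ik) => _ /vu ->.
- by rewrite leq_eqVlt (negPf jk) [(i <= k)%N]leq_eqVlt (negPf ik) => jk' ik'; exact: orth.
Qed.

Lemma sub_kermx_family k v u :
  (u <= kermx (\matrix_(i < k) v i)^T)%MS <-> forall i, (i < k)%N -> dot (v i) u = 0.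
Proof.
have uE (i : 'I_k) : (u *m (\matrix_(i < k) v i)^T) 0 i = dot (v i) u.
  by rewrite mulmx_coord trmxK rowK dotC.
split=> [/sub_kermxP uv i ik|uv]; first by rewrite -(uE (Ordinal ik)) uv mxE.
by apply/sub_kermxP/rowP => i; rewrite uE mxE uv.
Qed.

Lemma skew_family_perp k v om u : skew_family k v om ->
  (forall i, (i < 2 * k)%N -> dot (v i) u = 0) ->
  forall i, (i < 2 * k)%N -> dot (v i) (u *m S) = 0.
Proof.
move=> [_ vS] u0 i ik; apply/eqP; rewrite -oppr_eq0 -dot_skew//; apply/eqP.
have lk : (i./2 < k)%N by rewrite ltn_half_double -mul2n.
have [_ v_even v_odd] := vS _ lk.
have := odd_double_half i; rewrite -mul2n; case: (odd i) => /= iE.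
  by rewrite -iE add1n v_odd dotZl u0 ?mulr0//; lia.
by rewrite -iE add0n v_even dotZl u0 ?mulr0//; lia.
Qed.

Lemma skew_family_frequency N v om (k : R) : skew_family N v om ->
  (forall u, dot u u = 1 -> dot (u *m S) (u *m S) = k) -> forall l, (l < N)%N -> om l ^+ 2 = k.
Proof.
move=> [orth vS] norm_k l lN; have [_ v_even _] := vS l lN.
have even_lt : (2 * l < 2 * N)%N by rewrite ltn_mul2l.
have odd_lt : ((2 * l).+1 < 2 * N)%N by lia.
rewrite -(norm_k (v (2 * l)%N)); last by rewrite orth ?eqxx.
by rewrite v_even dotZl dotZr orth// eqxx mulr1 expr2.
Qed.

Hypothesis S_unit : S \in unitmx.

Lemma skew_plane_exists k v om : (2 * k < m)%N -> skew_family k v om -> exists u u' (c : R),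
  [/\ c != 0, dot u u = 1, dot u' u' = 1, dot u u' = 0 &
      [/\ u *m S = c *: u', u' *m S = - c *: u &
          forall i, (i < 2 * k)%N -> dot (v i) u = 0 /\ dot (v i) u' = 0]].
Proof.
move=> km fam; pose W := kermx (\matrix_(i < 2 * k) v i)^T.
have stabW : stablemx W (S *m S).
  apply/row_subP => i; rewrite row_mul mulmxA; apply/sub_kermx_family.
  by do 2!apply: (skew_family_perp fam); apply/sub_kermx_family; exact: row_sub.
have W0 : W != 0.
  by rewrite -mxrank_eq0 mxrank_ker subn_eq0 -ltnNge mxrank_tr (leq_ltn_trans (rank_leq_row _)).
have [|u [l [/sub_kermx_family uv u1 uSS]]] := symmetric_eigenvector _ W0 stabW.
  by rewrite trmx_mul skS mulmxN mulNmx opprK.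
have lE : l = - dot (u *m S) (u *m S).
  by rewrite -[l]mulr1 -u1 -dotZl -uSS mulmxA dot_skew.
have uS0 : u *m S != 0.
  apply: contraTneq (dot1_neq0 u1) => uS; rewrite negbK.
  by rewrite -(mulmxK S_unit u) uS mul0mx.
pose c := Num.sqrt (dot (u *m S) (u *m S)); have c0 : c != 0 by rewrite gt_eqF// sqrtr_gt0 dot_gt0.
exists u, (c^-1 *: (u *m S)), c; split=> //; first exact: normalize_dot1.
  by rewrite dotZr dotC dot_skew0// mulr0.
split; first by rewrite scalerA divff// scale1r.
  rewrite -scalemxAl -mulmxA uSS lE scalerA -[dot _ _]sqr_sqrtr ?dot_ge0// -/c.
  by congr (_ *: _); field.
by move=> i ik; rewrite dotZr (skew_family_perp fam uv ik) mulr0 uv.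
Qed.

Lemma skew_family_extend k v om : (2 * k < m)%N -> skew_family k v om ->
  exists v' om', skew_family k.+1 v' om'.
Proof.
move=> km fam; have [orth vS] := fam.
have [u [u' [c [c0 u1 u'1 uu' [uS u'S vu]]]]] := skew_plane_exists km fam.
pose v' := [eta [eta v with (2 * k)%N |-> u] with (2 * k).+1 |-> u'].
have v'k : v' (2 * k)%N = u by rewrite /v' /= eqxx ltn_eqF.
have v'k1 : v' (2 * k).+1 = u' by rewrite /v' /= eqxx.
have v'lt i : (i < 2 * k)%N -> v' i = v i.
  by move=> ik; rewrite /v' /= !ltn_eqF// ltnS ltnW.
exists v', [eta om with k |-> c]; split.
  rewrite mulnS add2n; apply: orthonormal_family_extend => //.
    by apply: orthonormal_family_extend => // i /vu[].
  move=> i; rewrite ltnS leq_eqVlt /= => /orP[/eqP ->|ik]; first by rewrite eqxx.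
  by rewrite ltn_eqF//; have [] := vu i ik.
move=> l; rewrite ltnS leq_eqVlt => /orP[/eqP ->|lk]; first by rewrite v'k v'k1 /= eqxx.
by rewrite !v'lt /= ?(ltn_eqF lk); [exact: vS | lia | lia].
Qed.

Lemma skew_family_exists k : (2 * k <= m.+1)%N -> exists v om, skew_family k v om.
Proof.
elim: k => [|k IH] km; first by exists (fun=> 0), (fun=> 0); split=> // i j; rewrite muln0.
rewrite mulnS add2n ltnS in km; have [v [om fam]] := IH (leq_trans (leqnSn _) (leqW km)).
exact: skew_family_extend fam.
Qed.

Lemma orthonormal_family_mx k v : orthonormal_family k v ->
  (\matrix_(i < k) v i) *m (\matrix_(i < k) v i)^T = 1%:M.
Proof.
move=> orth; apply/matrixP => i j; transitivity (dot (v i) (v j)); last by rewrite orth// mxE.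
by rewrite mxE; apply: eq_bigr => l _; rewrite !mxE.
Qed.

Lemma skew_family_full : exists N v om, m = (2 * N)%N /\ skew_family N v om.
Proof.
have [v [om fam]] : exists v om, skew_family (uphalf m) v om.
  by apply: skew_family_exists; rewrite mul2n uphalfE -[leqRHS]odd_double_half leq_addl.
exists (uphalf m), v, om; split=> //; apply/eqP; rewrite eqn_leq.
by rewrite (mulmx1_min (orthonormal_family_mx fam.1)) mul2n -leq_uphalf_double leqnn.
Qed.

End SkewNormalForm.

(** * The unit sphere and ellipsoids *)

Section Sphere.
Variables (R : realType) (m : nat).
Local Notation V := 'rV[R]_m.
Implicit Types (x y z : V).

Definition great_circle x y (t : R) := cos t *: x + sin t *: y.

Lemma great_circle_continuous x y : continuous (great_circle x y).
Proof.
move=> t; apply: cvgD; apply: cvgZr_tmp.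
  exact: continuous_cos.
exact: continuous_sin.
Qed.

Lemma great_circle_unit x y t : dot x x = 1 -> dot y y = 1 -> dot x y = 0 ->
  dot (great_circle x y t) (great_circle x y t) = 1.
Proof.
move=> x1 y1 xy; rewrite !(dotDl, dotDr, dotZl, dotZr) x1 y1 [dot y x]dotC xy.
by rewrite -[RHS](cos2Dsin2 t); ring.
Qed.

Lemma great_circle_through x z : (2 <= m)%N -> dot x x = 1 -> dot z z = 1 ->
  exists y t, [/\ dot y y = 1, dot x y = 0 & great_circle x y t = z].
Proof.
move=> m2 x1 z1; pose a := dot x z; pose w := z - a *: x.
have ww : dot w w = 1 - a ^+ 2.
  by rewrite !(dotBl, dotBr, dotZl, dotZr) x1 z1 [dot z x]dotC -/a; ring.
have xw : dot x w = 0 by rewrite dotBr dotZr x1 mulr1 subrr.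
have a1 : -1 <= a <= 1.
  by rewrite -ler_norml -(expr_le1 (n := 2))// real_normK ?num_real// -subr_ge0 -ww dot_ge0.
suff [y [y1 xy wE]] : exists y, [/\ dot y y = 1, dot x y = 0 & w = Num.sqrt (1 - a ^+ 2) *: y].
  exists y, (acos a); split=> //.
  by rewrite /great_circle acosK ?in_itv// sin_acos// -wE addrC subrK.
have [w0|w0] := eqVneq w 0.
  have [y y1 xy] := @exists_orthogonal _ _ [:: x] m2.
  by exists y; rewrite -ww w0 dot0l sqrtr0 scale0r y1 xy ?inE.
exists ((Num.sqrt (dot w w))^-1 *: w); split; first exact: normalize_dot1.
  by rewrite dotZr xw mulr0.
by rewrite -ww scalerA divff ?scale1r// gt_eqF// sqrtr_gt0 dot_gt0.
Qed.

Lemma unit_sphere_connected : (2 <= m)%N -> connected (@unit_sphere R m).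
Proof.
move=> m2; have [x x1 _] := @exists_orthogonal R m [::] (ltnW m2).
pose Y := [set y | dot y y = 1 /\ dot x y = 0].
have -> : @unit_sphere R m = \bigcup_(y in Y) range (great_circle x y).
  apply/seteqP; split=> [z z1|_ [y [y1 xy] [t _ <-]]]; last exact: great_circle_unit.
  by have [y [t [y1 xy <-]]] := great_circle_through m2 x1 z1; exists y => //; exists t.
apply: bigcup_connected => [|y _].
  by exists x => y _; exists 0; rewrite // /great_circle cos0 sin0 scale1r scale0r addr0.
apply: connected_continuous_connected; last exact/continuous_subspaceT/great_circle_continuous.
exact/connected_intervalP.
Qed.

End Sphere.

Section Ellipsoid.
Variables (R : realType) (m : nat).
Local Notation V := 'rV[R]_m.
Implicit Types (A : 'M[R]_m) (c x y v : V) (S : set V).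

Definition affine_map A c x : V := x *m A + c.

Lemma continuous_affine A c : continuous (affine_map A c).
Proof.
move=> x; have cA : {for x, continuous (fun y : V => y *m A)}.
  by apply: (@continuous_mulmx _ _ _ A V id); exact: cvg_id.
by apply: continuousD cA _; exact: cst_continuous.
Qed.

Lemma is_derive_affine A c x v : is_derive x v (affine_map A c) (v *m A).
Proof.
have := is_deriveD (is_derive_mulmx A (is_derive_id x v)) (is_derive_cst c x v).
by rewrite addr0.
Qed.

Lemma smooth_affine A c : smooth_on setT (affine_map A c).
Proof.
apply/(smooth_rowP _ openT) => i; have sA := smooth_mulmx A (smooth_id (@openT V)).
apply: smooth_eq (smooth_add (smooth_row i sA) (smooth_cst (c 0 i) openT)) => x _.
by rewrite [RHS]mxE.
Qed.

Lemma smooth_map_affine S A c : smooth_map_on S (affine_map A c).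
Proof.
move=> p _; exists setT, (affine_map A c); split=> //; split=> //.
exact: smooth_affine.
Qed.

Lemma affine_mapK A c : A \in unitmx ->
  cancel (affine_map A c) (affine_map (invmx A) (- (c *m invmx A))).
Proof. by move=> uA x; rewrite /affine_map mulmxDl mulmxK// addrK. Qed.

Lemma affine_mapVK A c : A \in unitmx ->
  cancel (affine_map (invmx A) (- (c *m invmx A))) (affine_map A c).
Proof. by move=> uA x; rewrite /affine_map mulmxDl mulNmx !mulmxKV// subrK. Qed.

Definition ellipsoid A c : set V := affine_map A c @^-1` @unit_sphere R m.

Definition ellipsoid_eqn A c x : R := dot (affine_map A c x) (affine_map A c x) - 1.

Lemma smooth_ellipsoid_eqn A c : smooth_on setT (ellipsoid_eqn A c).
Proof.
apply: smooth_add (smooth_cst (- 1) openT).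
by apply: smooth_dot; exact: smooth_affine.
Qed.

Lemma derive_ellipsoid_eqn A c x v :
  'D_v (ellipsoid_eqn A c) x = 2 * dot (affine_map A c x) (v *m A).
Proof.
have dA := is_derive_affine A c x v.
have [_ ->] := is_deriveB (is_derive_dot dA dA) (is_derive_cst (1 : R) x v).
by rewrite subr0 [dot (v *m A) _]dotC; ring.
Qed.

Lemma ellipsoid_eqnE A c x : ellipsoid A c x <-> ellipsoid_eqn A c x = 0.
Proof.
split=> [Ex|/eqP]; last by rewrite subr_eq0 => /eqP.
by rewrite /ellipsoid_eqn [dot _ _]Ex subrr.
Qed.

Section Invertible.
Variables (A : 'M[R]_m) (c : V).
Hypothesis uA : A \in unitmx.

Lemma ellipsoid_hypersurface : hypersurface (ellipsoid A c).
Proof.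
move=> p Ep; pose U := [set x | -1 < ellipsoid_eqn A c x].
have oU : open U.
  apply: open_comp (@open_gt _ (-1)) => x _.
  exact: smooth_continuous (smooth_ellipsoid_eqn A c) _.
exists U, (ellipsoid_eqn A c); split; first by rewrite /U /= (ellipsoid_eqnE A c p).1// ltrN10.
split; first exact: smooth_sub oU _ (smooth_ellipsoid_eqn A c).
split=> x Ux; last exact: ellipsoid_eqnE.
exists (affine_map A c x *m invmx A).
rewrite derive_ellipsoid_eqn mulmxKV// mulf_neq0//.
by move: Ux; rewrite /U /= ltrBrDl subrr => /gt_eqF ->.
Qed.

Lemma ellipsoid_connected : (2 <= m)%N -> connected (ellipsoid A c).
Proof.
move=> m2; have -> : ellipsoid A c =
    affine_map (invmx A) (- (c *m invmx A)) @` @unit_sphere R m.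
  apply/seteqP; split=> [x Ex|_ [y y1 <-]]; last by rewrite /ellipsoid /= affine_mapVK.
  by exists (affine_map A c x) => //; rewrite affine_mapK.
apply: connected_continuous_connected; first exact: unit_sphere_connected.
exact/continuous_subspaceT/continuous_affine.
Qed.

Lemma ellipsoid_diffeomorphic : diffeomorphic (ellipsoid A c) (@unit_sphere R m).
Proof.
exists (affine_map A c), (affine_map (invmx A) (- (c *m invmx A))).
split=> //; split; first by move=> y y1; rewrite /ellipsoid /= affine_mapVK.
split; first by move=> x _; rewrite affine_mapK.
split; first by move=> y _; rewrite affine_mapVK.
by split; exact: smooth_map_affine.
Qed.

End Invertible.

Section ShapeOperator.
Variables (M : set V) (xi nu : V -> V) (A : 'M[R]_m) (c : V).
Hypotheses (uA : A \in unitmx) (skA : A^T = - A) (ME : M = ellipsoid A c).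
Hypotheses (xi_vf : vector_field M xi) (xiE : forall x, M x -> xi x = affine_map A c x).
Hypothesis nu_normal : unit_normal M nu.

Lemma ellipsoid_tangent_dot p v : M p -> tangent M p v -> dot (xi p *m A) v = 0.
Proof.
move=> Mp Tv; have g0 : forall x, M x -> setT x -> ellipsoid_eqn A c x = 0.
  by move=> x; rewrite ME => Ex _; apply/ellipsoid_eqnE.
have /eqP := tangent_vanish Mp Tv (smooth_ellipsoid_eqn A c) I g0.
rewrite derive_ellipsoid_eqn mulf_eq0 pnatr_eq0 /= => /eqP xiv.
by rewrite dot_skew// xiE// xiv oppr0.
Qed.

Lemma shape_operator_dot U G p : M p -> local_ext M nu p U G ->
  - dot ('D_(xi p) G p) (xi p) = dot (nu p) (xi p *m A).
Proof.
move=> Mp [Up [sG GE]]; have [_ nuP] := nu_normal; have Txi := xi_vf.2 p Mp.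
have sA : smooth_on U (affine_map A c).
  exact: smooth_sub (smooth_open sG) (@subsetT _ _) (smooth_affine A c).
have g0 x : M x -> U x -> dot (G x) (affine_map A c x) = 0.
  move=> Mx Ux; rewrite GE// -xiE//.
  by apply: (nuP x Mx).2; exact: xi_vf.2.
have := tangent_vanish Mp Txi (smooth_dot sG sA) Up g0.
have [_ ->] := is_derive_dot (smooth_is_derive (xi p) sG Up) (is_derive_affine A c p (xi p)).
by rewrite GE// -xiE// => /eqP; rewrite addr_eq0 => /eqP ->.
Qed.

Lemma shape_xi_const_norm : shape_xi_const M nu xi ->
  exists k, forall u, dot u u = 1 -> dot (u *m A) (u *m A) = k.
Proof.
move=> [k shape_k]; exists (k ^+ 2) => u u1.
pose p := affine_map (invmx A) (- (c *m invmx A)) u.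
have Mp : M p by rewrite ME /ellipsoid /= affine_mapVK.
have <- : xi p = u by rewrite xiE// affine_mapVK.
have hM : hypersurface M by rewrite ME; exact: ellipsoid_hypersurface.
have [nu_smooth nuP] := nu_normal; have [nu1 nuT] := nuP p Mp.
have [U [G ext]] := nu_smooth p Mp.
rewrite (normal_scalar hM Mp nu1 nuT (fun v => ellipsoid_tangent_dot Mp)).
have -> : dot (xi p *m A) (nu p) = k.
  by rewrite dotC -(shape_operator_dot Mp ext); exact: (shape_k p U G).
by rewrite dotZl dotZr nu1 mulr1 expr2.
Qed.

End ShapeOperator.
End Ellipsoid.

(** * Complex coordinates *)

Section Coordinates.
Variables (R : realType) (n N : nat).
Hypothesis nN : n.+1 = (2 * N)%N.
Local Notation V := 'rV[R]_n.+1.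
Implicit Types (x y : V) (v : nat -> V) (om : nat -> R) (S : 'M[R]_n.+1).

Lemma sum_pairs (W : zmodType) (f : nat -> W) :
  \sum_(i < n.+1) f i = \sum_(l < N) (f (2 * l)%N + f (2 * l).+1).
Proof.
rewrite -(big_mkord xpredT) nN; elim: N => [|k IH]; first by rewrite muln0 big_geq// big_ord0.
by rewrite mulnS add2n !big_nat_recr//= IH big_ord_recr /= addrA.
Qed.

Lemma coord_ord y (i : 'I_n.+1) : Defs.coord y i = y 0 i.
Proof. by rewrite /Defs.coord ltn_ord inord_val. Qed.

Lemma dot_pairs x y : dot x y = \sum_(l < N)
  (Defs.coord x (2 * l) * Defs.coord y (2 * l) + Defs.coord x (2 * l).+1 * Defs.coord y (2 * l).+1).
Proof.
rewrite -(sum_pairs (fun i => Defs.coord x i * Defs.coord y i)).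
by apply: eq_bigr => i _; rewrite !coord_ord.
Qed.

Lemma coord_rot_even om y (l : 'I_N) :
  Defs.coord (rot_field om y) (2 * l) = - (om l * Defs.coord y (2 * l).+1).
Proof.
have ln : (2 * l < n.+1)%N by rewrite nN ltn_mul2l ltn_ord.
by rewrite {1}/Defs.coord ln mxE inordK// mul2n odd_double doubleK.
Qed.

Lemma coord_rot_odd om y (l : 'I_N) :
  Defs.coord (rot_field om y) (2 * l).+1 = om l * Defs.coord y (2 * l).
Proof.
have ln : ((2 * l).+1 < n.+1)%N by rewrite nN; have := ltn_ord l; lia.
by rewrite {1}/Defs.coord ln mxE inordK// mul2n /= odd_double /= uphalf_double.
Qed.

Lemma dot_rot om y : dot (rot_field om y) (rot_field om y) =
  \sum_(l < N) om l ^+ 2 * (Defs.coord y (2 * l) ^+ 2 + Defs.coord y (2 * l).+1 ^+ 2).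
Proof.
by rewrite dot_pairs; apply: eq_bigr => l _; rewrite coord_rot_even coord_rot_odd; ring.
Qed.

Lemma cellipsoidE om y : cellipsoid N om y = (dot (rot_field om y) (rot_field om y) = 1).
Proof. by rewrite dot_rot. Qed.

Lemma cellipsoid_round om (r : R) : (forall l, (l < N)%N -> om l ^+ 2 = r) -> r != 0 ->
  cellipsoid N om = [set y : V | dot y y = r^-1].
Proof.
move=> omr r0; have rotE y : dot (rot_field om y) (rot_field om y) = r * dot y y.
  rewrite dot_rot dot_pairs mulr_sumr; apply: eq_bigr => l _.
  by rewrite omr// -!expr2.
apply/seteqP; split=> y; rewrite cellipsoidE rotE /=.
  by move=> ry; apply: (mulfI r0); rewrite ry divff.
by move=> ->; rewrite divff.
Qed.

Lemma mulmx_family v y : y *m (\matrix_(i < n.+1) v i) =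
  \sum_(l < N) (Defs.coord y (2 * l) *: v (2 * l)%N + Defs.coord y (2 * l).+1 *: v (2 * l).+1).
Proof.
rewrite mulmx_sum_row -(sum_pairs (fun i => Defs.coord y i *: v i)).
by apply: eq_bigr => i _; rewrite coord_ord rowK.
Qed.

Lemma rot_field_mulmx S v om y : skew_family S N v om ->
  y *m (\matrix_(i < n.+1) v i) *m S = rot_field om y *m (\matrix_(i < n.+1) v i).
Proof.
move=> [_ vS]; rewrite !mulmx_family mulmx_suml; apply: eq_bigr => l _.
have [_ v_even v_odd] := vS l (ltn_ord l).
rewrite mulmxDl -!scalemxAl v_even v_odd coord_rot_even coord_rot_odd !scalerA addrC.
by congr (_ *: _ + _ *: _); ring.
Qed.

Lemma skew_family_unitary S v om : skew_family S N v om ->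
  (\matrix_(i < n.+1) v i) *m (\matrix_(i < n.+1) v i)^T = 1%:M.
Proof.
move=> [orth _]; apply: orthonormal_family_mx => i j i_lt j_lt.
by apply: orth; rewrite -nN.
Qed.

Section EllipsoidNormalForm.
Variables (A : 'M[R]_n.+1) (c : V) (v : nat -> V) (om : nat -> R).
Hypotheses (uA : A \in unitmx) (fam : skew_family A N v om).
Let Q := \matrix_(i < n.+1) v i.

Lemma affine_rot_field y : affine_map A c (y *m Q - c *m invmx A) = rot_field om y *m Q.
Proof. by rewrite /affine_map mulmxBl mulmxKV// subrK (rot_field_mulmx _ fam). Qed.

Lemma ellipsoid_normal_form :
  ellipsoid A c = [set y *m Q - c *m invmx A | y in cellipsoid N om].
Proof.
have QQ : Q *m Q^T = 1%:M := skew_family_unitary fam.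
have ellE y : ellipsoid A c (y *m Q - c *m invmx A) <-> cellipsoid N om y.
  rewrite /ellipsoid /= affine_rot_field cellipsoidE /unit_sphere /=.
  by rewrite dot_mulmxl -mulmxA QQ mulmx1.
apply/seteqP; split=> [x Ex|_ [y /ellE Ey <-] //].
have xE : (x + c *m invmx A) *m Q^T *m Q - c *m invmx A = x.
  by rewrite -mulmxA (mulmx1C QQ) mulmx1 addrK.
by exists ((x + c *m invmx A) *m Q^T) => //; apply/ellE; rewrite xE.
Qed.

End EllipsoidNormalForm.
End Coordinates.

Theorem theorem1 (R : realType) (n : nat) (M : set 'rV[R]_n.+1)
    (xi : 'rV[R]_n.+1 -> 'rV[R]_n.+1) :
  (3 <= n)%N ->
  hypersurface M -> compact M -> connected M -> M !=set0 ->
  killing M xi -> (forall p, M p -> dot (xi p) (xi p) = 1) ->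
  exists (N : nat) (Q : 'M[R]_n.+1) (b : 'rV[R]_n.+1) (omega : nat -> R),
    n.+1 = (2 * N)%N /\
    diffeomorphic M ((@unit_sphere R n.+1)) /\
    Q *m Q^T = 1%:M /\
    (forall k, (k < N)%N -> omega k != 0) /\
    M = [set y *m Q + b | y in cellipsoid N omega] /\
    (forall y, cellipsoid N omega y -> xi (y *m Q + b) = rot_field omega y *m Q) /\
    (forall nu : 'rV[R]_n.+1 -> 'rV[R]_n.+1,
          unit_normal M nu -> shape_xi_const M nu xi ->
          (forall k, (k < N)%N -> omega k ^+ 2 = omega 0%N ^+ 2) /\
          M = [set y *m Q + b | y in
                 [set y | dot y y = (omega 0%N ^+ 2)^-1]]).
Proof.
move=> n3 hM cM conM M0 kM unit_xi.
have [A [c [skA uA xiE]]] := affine_unit_killing (n3 : (4 <= n.+1)%N) hM cM conM M0 kM unit_xi.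
have [N [v [om [nN fam]]]] := skew_family_full skA uA.
have ME : M = ellipsoid A c.
  apply: compact_hypersurface_eq => // [|x Mx|]; first exact: ellipsoid_hypersurface.
    by rewrite /ellipsoid /= /affine_map -xiE//; exact: unit_xi.
  by apply: ellipsoid_connected => //; lia.
have om0 k : (k < N)%N -> om k != 0 by move=> kN; have [_ /(_ k kN)[]] := fam.
have MN := ellipsoid_normal_form nN c uA fam; rewrite -ME in MN.
exists N, (\matrix_(i < n.+1) v i), (- (c *m invmx A)), om.
split=> //; split; first by rewrite ME; exact: ellipsoid_diffeomorphic.
split; first exact: skew_family_unitary nN _ _ _ fam.
split=> //; split=> //; split=> [y Ny|nu nu_normal nu_const].
  by rewrite xiE -?(affine_rot_field nN c uA fam)// MN; exists y.
have [k norm_k] := shape_xi_const_norm uA skA ME kM.1 xiE nu_normal nu_const.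
have om_k := skew_family_frequency fam norm_k.
have N0 : (0 < N)%N by lia.
have om_const l : (l < N)%N -> om l ^+ 2 = om 0%N ^+ 2 by move=> lN; rewrite !om_k.
split=> //; rewrite -(cellipsoid_round nN om_const)// expf_neq0//.
exact: om0.
Qed.
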